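(* Let $R=\bigoplus_{i\in\mathbb N}R_i$ be a standard $\mathbb N$-graded ring over a separably closed field $k$, i.e. $R_0=k$ and $R$ is finitely generated as a $k$-algebra by $R_1$. If $\operatorname{depth}(R)\geq 3$, then $\widetilde{H}_0(\Delta(R);k)=\widetilde{H}_1(\Delta(R);k)=0$.
   Context: For such a graded ring $R$, let $\mathfrak m=\bigoplus_{i>0}R_i$ be the ideal of elements of positive degree and let $\mathfrak p_1,\dots,\mathfrak p_n$ be the minimal primes of $R$. $\Delta(R)$ is the simplicial complex on the vertex set $\{1,\dots,n\}$ in which a subset $\{i_0,\dots,i_s\}$ is a face if and only if $\sqrt{\mathfrak p_{i_0}+\cdots+\mathfrak p_{i_s}}\neq\mathfrak m$. $\widetilde{H}_j(\Delta(R);k)$ denotes the $j$-th reduced homology of $\Delta(R)$ with coefficients in $k$. The depth is taken with respect to $\mathfrak m$. *)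

(* Defs.v *)
From HB Require Import structures.
From mathcomp Require Import all_boot all_order all_algebra all_field.
Set Implicit Arguments. Unset Strict Implicit. Unset Printing Implicit Defensive.
Import GRing.Theory.
Local Open Scope ring_scope.

Definition same_set (T : Type) (A B : T -> Prop) := forall x, A x <-> B x.

Definition is_ideal (R : comNzRingType) (I : R -> Prop) : Prop :=
  I 0 /\ (forall a b, I a -> I b -> I (a + b)) /\ (forall r a, I a -> I (r * a)).

Definition is_prime_ideal (R : comNzRingType) (P : R -> Prop) : Prop :=
  is_ideal P /\ ~ P 1 /\ (forall a b, P (a * b) -> P a \/ P b).

Definition is_minimal_prime (R : comNzRingType) (P : R -> Prop) : Prop :=
  is_prime_ideal P /\
  forall Q : R -> Prop, is_prime_ideal Q -> (forall r, Q r -> P r) ->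
    forall r, P r -> Q r.

Definition rad (R : comNzRingType) (I : R -> Prop) : R -> Prop :=
  fun r => exists m : nat, I (r ^+ m).

Definition ideal_sum (R : comNzRingType) (n : nat) (p : 'I_n -> R -> Prop)
  (F : {set 'I_n}) : R -> Prop :=
  fun r => exists f : 'I_n -> R,
    (forall i, i \in F -> p i (f i)) /\ r = \sum_(i in F) f i.

Definition gen_ideal (R : comNzRingType) (xs : seq R) : R -> Prop :=
  fun r => exists a : seq R, size a = size xs /\
    r = \sum_(i < size xs) a`_i * xs`_i.

Definition regular_seq (R : comNzRingType) (xs : seq R) : Prop :=
  (forall i, (i < size xs)%N -> forall r : R,
      gen_ideal (take i xs) (xs`_i * r) -> gen_ideal (take i xs) r)
  /\ ~ gen_ideal xs 1.

Definition depth_ge (R : comNzRingType) (m : R -> Prop) (d : nat) : Prop :=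
  exists xs : seq R, size xs = d /\ (forall x, x \in xs -> m x) /\ regular_seq xs.

Definition is_k_subalgebra (k : fieldType) (R : comAlgType k) (S : R -> Prop) :=
  S 1 /\ (forall a b, S a -> S b -> S (a + b)) /\
  (forall a b, S a -> S b -> S (a * b)) /\ (forall (c : k) a, S a -> S (c *: a)).

Record std_graded (k : fieldType) (R : comAlgType k) (Rg : nat -> R -> Prop)
  : Prop := {
  gr_zero : forall i, Rg i 0;
  gr_add : forall i a b, Rg i a -> Rg i b -> Rg i (a + b);
  gr_scale : forall i (c : k) a, Rg i a -> Rg i (c *: a);
  gr_mul : forall i j a b, Rg i a -> Rg j b -> Rg (i + j)%N (a * b);
  gr_span : forall r : R, exists (N : nat) (f : nat -> R),
      (forall i, Rg i (f i)) /\ r = \sum_(i < N) f i;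
  gr_indep : forall (N : nat) (f : nat -> R), (forall i, Rg i (f i)) ->
      \sum_(i < N) f i = 0 -> forall i, (i < N)%N -> f i = 0;
  gr_deg0 : forall r : R, Rg 0%N r <-> exists c : k, r = c%:A;
  gr_std : exists (n : nat) (x : 'I_n -> R), (forall i, Rg 1%N (x i)) /\
      forall S : R -> Prop, is_k_subalgebra S -> (forall i, S (x i)) ->
        forall r, S r
}.

Definition irrelevant_ideal (k : fieldType) (R : comAlgType k)
  (Rg : nat -> R -> Prop) : R -> Prop :=
  fun r => exists (N : nat) (f : nat -> R),
    (forall i, Rg i (f i)) /\ f 0%N = 0 /\ r = \sum_(i < N) f i.

Definition separably_closed (k : fieldType) : Prop :=
  forall p : {poly k}, (1 < size p)%N -> separable_poly p -> exists x, root p x.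

Definition Delta (k : fieldType) (R : comAlgType k) (Rg : nat -> R -> Prop)
  (n : nat) (p : 'I_n -> R -> Prop) (F : {set 'I_n}) : Prop :=
  ~ same_set (rad (ideal_sum p F)) (irrelevant_ideal Rg).

(* simplicial chains: functions on subsets of the vertex set; a face F with
   #|F| = j+1 is a j-simplex, and sets of size 0 give the augmentation
   degree -1 (reduced complex). *)
Definition chain_supp (k : fieldType) (n : nat) (face : {set 'I_n} -> Prop)
  (d : nat) (c : {set 'I_n} -> k) : Prop :=
  forall F, c F != 0 -> face F /\ #|F| = d.

(* simplicial boundary: d[v_0 < ... < v_j] = sum_i (-1)^i [.. v_i omitted ..] *)
Definition bdry (k : fieldType) (n : nat) (c : {set 'I_n} -> k)
  (G : {set 'I_n}) : k :=
  \sum_(v : 'I_n | v \notin G) (-1) ^+ #|[set w in G | (w < v)%N]| * c (v |: G).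

Definition reduced_homology_vanishes (k : fieldType) (n : nat)
  (face : {set 'I_n} -> Prop) (j : nat) : Prop :=
  forall c : {set 'I_n} -> k, chain_supp face j.+1 c ->
    (forall G, bdry c G = 0) ->
    exists e : {set 'I_n} -> k, chain_supp face j.+2 e /\
      forall F, bdry e F = c F.

(* Main.v *)
(* A functional on the simplicial chains of Delta(R) that kills boundaries is a
   simplicial cocycle. On Proj R, covered by opens g s <> 0 each meeting only the
   components of a face, a 1-cocycle becomes a Cech cocycle of constants in k.
   As depth R >= 3, it splits: c s u = f s / g s - f u / g u with f s / g s of
   degree 0. On a component V(p i), f s / g s corrected by a constant depending
   on s is independent of s, so it is a global function on an integral projective
   scheme; such a function is algebraic over k, hence, k being separably closed,
   has a Frobenius power in k. Comparing two components along a common point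
   writes a Frobenius power of the simplicial cocycle as a coboundary. So the
   functional, once Frobenius-twisted, vanishes on cycles. The same argument with
   H^0 in place of H^1 gives connectedness. *)

Require Import Defs.
From HB Require Import structures.
From mathcomp Require Import all_boot all_order all_algebra all_field.
From mathcomp Require Import boolp ring.
From mathcomp Require classical_sets.
Set Implicit Arguments. Unset Strict Implicit. Unset Printing Implicit Defensive.
(* [Defs.rad] is shadowed by a MathComp name unless [Defs] is imported again. *)
Import Defs GRing.Theory.
Local Open Scope ring_scope.

(** * Ideals, minimal primes and regular elements *)

Section Ideals.
Variable R : comNzRingType.
Implicit Types (I P : R -> Prop) (x y : R).

Lemma ideal_mulr I r a : is_ideal I -> I a -> I (a * r).
Proof. by case=> _ [_ IM] Ia; rewrite mulrC; apply: IM. Qed.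

Lemma ideal_mull I r a : is_ideal I -> I a -> I (r * a).
Proof. by case=> _ [_ IM]; apply: IM. Qed.

Lemma ideal_add I a b : is_ideal I -> I a -> I b -> I (a + b).
Proof. by case=> _ [ID _]; apply: ID. Qed.

Lemma ideal_opp I a : is_ideal I -> I a -> I (- a).
Proof. by move=> idI Ia; rewrite -mulN1r; apply: ideal_mull. Qed.

Lemma ideal_sub I a b : is_ideal I -> I a -> I b -> I (a - b).
Proof. by move=> idI Ia Ib; apply: ideal_add => //; apply: ideal_opp. Qed.

Lemma ideal_big_sum I (T : Type) (s : seq T) (Q : pred T) (F : T -> R) :
  is_ideal I -> (forall i, Q i -> I (F i)) ->
  I (\sum_(i <- s | Q i) F i).
Proof. by case=> I0 [ID _] IF; apply: big_ind. Qed.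

Lemma ideal_expW I x m n : is_ideal I -> (m <= n)%N -> I (x ^+ m) -> I (x ^+ n).
Proof. by move=> idI le_mn; rewrite -(subnK le_mn) exprD; apply: ideal_mull. Qed.

Lemma ideal_rad I : is_ideal I -> is_ideal (rad I).
Proof.
move=> idI; split; first by exists 1%N; rewrite expr1; case: idI.
split=> [a b [m Im] [n In]|r a [m Im]]; last first.
  by exists m; rewrite exprMn; apply: ideal_mull.
exists (m + n)%N; rewrite exprDn; apply: ideal_big_sum => // i _.
rewrite -mulr_natr; apply: ideal_mulr => //.
have [le_in|lt_ni] := leqP i n; last first.
  by apply: ideal_mull => //; apply: (ideal_expW idI _ In); apply: ltnW.
apply: ideal_mulr => //; apply: (ideal_expW idI _ Im).
by rewrite -addnBA // leq_addr.
Qed.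

Lemma ideal_rad_exp I x n : rad I (x ^+ n) -> rad I x.
Proof. by case=> m; rewrite -exprM => Ix; exists (n * m)%N. Qed.

Lemma rad_sub I x : I x -> rad I x.
Proof. by exists 1%N; rewrite expr1. Qed.

Lemma rad_mono I P x : (forall y, I y -> P y) -> rad I x -> rad P x.
Proof. by move=> sIP [m Im]; exists m; apply: sIP. Qed.

Lemma prime_exp P x n : is_prime_ideal P -> P (x ^+ n) -> P x.
Proof.
case=> [_ [P1 PM]]; elim: n => [/P1 //|n IHn].
by rewrite exprS => /PM[|/IHn].
Qed.

Lemma prime_prod P (T : Type) (s : seq T) (F : T -> R) :
  is_prime_ideal P -> P (\prod_(i <- s) F i) -> exists i, P (F i).
Proof.
case=> [_ [P1 PM]]; elim: s => [|i s IHs]; first by rewrite big_nil.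
by rewrite big_cons => /PM[Pi|/IHs//]; exists i.
Qed.

Definition gen_fam (S : finType) (g : S -> R) : R -> Prop :=
  fun r => exists b : S -> R, r = \sum_s b s * g s.

Lemma ideal_gen_fam (S : finType) (g : S -> R) : is_ideal (gen_fam g).
Proof.
split; first by exists (fun=> 0); rewrite big1 // => s; rewrite mul0r.
split=> [a b [u ->] [v ->]|r a [u ->]].
  exists (fun s => u s + v s).
  by rewrite -big_split; apply: eq_bigr => s _; rewrite mulrDl.
exists (fun s => r * u s).
by rewrite mulr_sumr; apply: eq_bigr => s _; rewrite mulrA.
Qed.

Lemma gen_fam_mem (S : finType) (g : S -> R) s : gen_fam g (g s).
Proof.
exists (fun u => (u == s)%:R).
rewrite (bigD1 s) //= eqxx mul1r big1 ?addr0 // => u /negPf->.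
by rewrite mul0r.
Qed.

Lemma gen_fam_min (S : finType) (g : S -> R) I r :
  is_ideal I -> (forall s, I (g s)) -> gen_fam g r -> I r.
Proof.
by move=> idI Ig [b ->]; apply: ideal_big_sum => // s _; apply: ideal_mull.
Qed.

(** Powers do not change the open set where some [g s] is nonzero, so for every [M] a power of [r]
    is a combination of the [g s ^+ M]: a partition of unity with cleared denominators. *)
Lemma rad_gen_fam_exp (S : finType) (g : S -> R) M r :
  rad (gen_fam g) r -> rad (gen_fam (fun s => g s ^+ M)) r.
Proof.
case=> N /gen_fam_min genr; apply: (@ideal_rad_exp _ _ N); apply: genr.
  exact/ideal_rad/ideal_gen_fam.
by move=> s; exists M; apply: gen_fam_mem (fun s => g s ^+ M) s.
Qed.

Lemma ideal_sum_ideal n (p : 'I_n -> R -> Prop) F :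
  (forall i, is_ideal (p i)) -> is_ideal (ideal_sum p F).
Proof.
move=> idp; split.
  by exists (fun=> 0); split=> [i _|]; [case: (idp i)|rewrite big1].
split=> [a b [u [pu ->]] [v [pv ->]]|r a [u [pu ->]]].
  exists (fun i => u i + v i); split; last by rewrite big_split.
  by move=> i iF; apply: ideal_add; auto.
exists (fun i => r * u i); split; last by rewrite mulr_sumr.
by move=> i iF; apply: ideal_mull; auto.
Qed.

Lemma ideal_sum_mem n (p : 'I_n -> R -> Prop) (F : {set 'I_n}) i r :
  (forall i, is_ideal (p i)) -> i \in F -> p i r -> ideal_sum p F r.
Proof.
move=> idp iF pr; exists (fun j => if j == i then r else 0); split=> [j _|].
  by case: eqP => [->//|_]; case: (idp j).
rewrite (bigD1 i) //= eqxx big1 ?addr0 // => j /andP[_ /negPf->] //.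
Qed.

Lemma ideal_sum_sub n (p : 'I_n -> R -> Prop) (F : {set 'I_n}) I r :
  is_ideal I -> (forall i s, i \in F -> p i s -> I s) ->
  ideal_sum p F r -> I r.
Proof.
move=> idI sub [f [pf ->]]; apply: ideal_big_sum => // i iF.
by apply: (sub i); last exact: pf.
Qed.

End Ideals.

Section MinimalPrimes.
Variable R : comNzRingType.

(* The complement of a maximal multiplicative set avoiding 0 is a minimal
   prime: x outside it satisfies s * x ^+ m = 0 for some s inside. *)
Lemma nonnilpotent_minimal_prime (a : R) :
  (forall n, a ^+ n != 0) -> exists P, is_minimal_prime P /\ ~ P a.
Proof.
move=> a_nil.
pose mulset (S : classical_sets.set R) := (exists x, S x) ->
  [/\ S 1, S a, ~ S 0 & forall x y, S x -> S y -> S (x * y)].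
have [|S [mS maxS]] := @classical_sets.Zorn_bigcup R mulset.
  move=> F mF totF [x [X FX Xx]].
  have [X1 Xa _ _] := mF _ FX (ex_intro _ _ Xx).
  split; [by exists X|by exists X| |].
  - by move=> [Y FY Y0]; have [_ _ /(_ Y0)] := mF _ FY (ex_intro _ _ Y0).
  - move=> y z [Y FY Yy] [Z FZ Zz].
    have [_ _ _ YM] := mF _ FY (ex_intro _ _ Yy).
    have [_ _ _ ZM] := mF _ FZ (ex_intro _ _ Zz).
    have [sYZ|sZY] := totF _ _ FY FZ.
      by exists Z => //; apply: ZM => //; apply: sYZ.
    by exists Y => //; apply: YM => //; apply: sZY.
have neS : exists x, S x.
  apply: contrapT => S0; pose A : classical_sets.set R := fun x => exists n, x = a ^+ n.
  apply: (maxS A); first split.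
  - by move=> x Sx; case: S0; exists x.
  - by move=> sAS; apply: S0; exists 1; apply: sAS; exists 0%N.
  move=> _; split; [by exists 0%N|by exists 1%N| |].
    by move=> [n /esym/eqP]; apply/negP.
  by move=> _ _ [n ->] [m ->]; exists (n + m)%N; rewrite exprD.
have [S1 Sa S0 SM] := mS neS.
have SX x n : S x -> S (x ^+ n).
  by move=> Sx; elim: n => [|n IHn]; rewrite ?expr0 // exprS; apply: SM.
have out x : ~ S x -> exists s m, S s /\ s * x ^+ m = 0.
  move=> nSx; apply: contrapT => nex.
  pose A : classical_sets.set R := fun z => exists s m, S s /\ z = s * x ^+ m.
  apply: (maxS A); first split.
  - by move=> s Ss; exists s, 0%N; rewrite mulr1.
  - by move=> sAS; apply: nSx; apply: sAS; exists 1, 1%N; rewrite mul1r.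
  move=> _; split.
  - by exists 1, 0%N; rewrite mulr1.
  - by exists a, 0%N; rewrite mulr1.
  - by move=> [s [m [Ss /esym sm]]]; apply: nex; exists s, m.
  - move=> _ _ [s [m [Ss ->]]] [t [l [St ->]]]; exists (s * t), (m + l)%N.
    by split; [apply: SM|rewrite exprD; ring].
have kill x s m : S s -> s * x ^+ m = 0 -> ~ S x.
  by move=> Ss sx0 Sx; apply: S0; rewrite -sx0; apply: SM => //; apply: SX.
exists (fun x => ~ S x); split; last by apply.
split; last first.
  move=> Q [idQ [Q1 QM]] sQ x /out[s [m [Ss sx0]]].
  have /QM[/sQ//|] : Q (s * x ^+ m) by rewrite sx0; case: idQ.
  exact: prime_exp.
split; last first.
  split; first by apply.
  by move=> x y; rewrite -not_andP => nSxy [Sx Sy]; apply: nSxy; apply: SM.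
split=> //; split.
  move=> x y /out[s [m [Ss sx]]] /out[t [l [St ty]]].
  have id_ann : is_ideal (fun z => s * t * z = 0).
    split; first by rewrite mulr0.
    split=> [u v u0 v0|r u u0]; first by rewrite mulrDr u0 v0 addr0.
    by rewrite mulrCA u0 mulr0.
  have [_ [radD _]] := ideal_rad id_ann.
  have [||N] := radD x y.
  - by exists m; rewrite mulrAC sx mul0r.
  - by exists l; rewrite -mulrA ty mulr0.
  by apply: kill; apply: SM.
move=> r x /out[s [m [Ss sx]]]; apply: (@kill _ s m) => //.
by rewrite exprMn mulrCA sx mulr0.
Qed.

End MinimalPrimes.

Section RegularElements.
Variable R : comNzRingType.
Implicit Types (I : R -> Prop) (x y z : R).

Definition nzd_mod I y := forall r, I (y * r) -> I r.

(** The ideal [I + (x)]; iterating it describes a regular sequence one element at a time. *)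
Definition adjoin I x : R -> Prop := fun r => exists a, I (r - a * x).

Lemma ideal_adjoin I x : is_ideal I -> is_ideal (adjoin I x).
Proof.
move=> idI; split; first by exists 0; rewrite mul0r subr0; case: idI.
split=> [a b [u Iu] [v Iv]|r a [u Iu]].
  exists (u + v); have -> : a + b - (u + v) * x = (a - u * x) + (b - v * x).
    by ring.
  exact: ideal_add.
exists (r * u); have -> : r * a - r * u * x = r * (a - u * x) by ring.
exact: ideal_mull.
Qed.

Lemma nzd_mod_exp I y n : nzd_mod I y -> nzd_mod I (y ^+ n).
Proof.
move=> Iy; elim: n => [|n IHn] r; first by rewrite mul1r.
by rewrite exprS -mulrA => /Iy/IHn.
Qed.

(** [R / (I, x ^+ n.+1)] is an extension of [R / (I, x)] by a copy of [R / (I, x ^+ n)], and [y]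
    acts injectively on both. *)
Lemma nzd_adjoin_exp I x y n : is_ideal I -> nzd_mod I x ->
  nzd_mod (adjoin I x) y -> nzd_mod (adjoin I (x ^+ n)) y.
Proof.
move=> idI Ix Iy; elim: n => [|n IHn] r.
  by move=> _; exists r; rewrite mulr1 subrr; case: idI.
case=> s Is; have [r' Ir'] : adjoin I x r.
  by apply: Iy; exists (s * x ^+ n); rewrite -mulrA -exprSr.
have [v Iv] : adjoin I (x ^+ n) r'.
  apply: IHn; exists s; apply: Ix.
  have -> : x * (y * r' - s * x ^+ n) =
    (y * r - s * x ^+ n.+1) - y * (r - r' * x) by rewrite exprS; ring.
  by apply: ideal_sub => //; apply: ideal_mull.
exists v; have -> : r - v * x ^+ n.+1 = (r - r' * x) + x * (r' - v * x ^+ n).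
  by rewrite exprS; ring.
by apply: ideal_add => //; apply: ideal_mull.
Qed.

(** If [x * r = s * y] modulo [I], then [y * s] lies in [I + (x)], so [s = s' * x] modulo [I], and
    cancelling [x] leaves [r = s' * y]. *)
Lemma nzd_adjoin_swap I x y : is_ideal I -> nzd_mod I x ->
  nzd_mod (adjoin I x) y -> nzd_mod (adjoin I y) x.
Proof.
move=> idI Ix Iy r [s Is].
have [s' Is'] : adjoin I x s.
  apply: Iy; exists r; have -> : y * s - r * x = - (x * r - s * y) by ring.
  exact: ideal_opp.
exists s'; apply: Ix.
have -> : x * (r - s' * y) = (x * r - s * y) + y * (s - s' * x) by ring.
by apply: ideal_add => //; apply: ideal_mull.
Qed.

Lemma adjoinC I x y r : adjoin (adjoin I x) y r -> adjoin (adjoin I y) x r.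
Proof.
case=> a [b Iab]; exists b, a.
by have -> : r - b * x - a * y = r - a * y - b * x by ring.
Qed.

(* Powers of the first element: after exchanging x and y, only the last of the
   elements adjoined is raised to a power. *)
Lemma nzd_adjoin2_exp I x y z n : is_ideal I -> nzd_mod I x ->
  nzd_mod (adjoin I x) y -> nzd_mod (adjoin (adjoin I x) y) z ->
  nzd_mod (adjoin (adjoin I (x ^+ n)) y) z.
Proof.
move=> idI Ix Iy Iz r /adjoinC zr; apply: adjoinC; move: zr.
apply: nzd_adjoin_exp; first exact: ideal_adjoin.
  exact: nzd_adjoin_swap.
by move=> s /adjoinC/Iz/adjoinC.
Qed.

End RegularElements.

(** * Gluing sections and splitting cocycles on the punctured spectrum *)

Section Gluing.
Variables (R : comNzRingType) (S : finType) (g : S -> R).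
Implicit Types (I : R -> Prop) (x y z : R).

(* Degree-0 local cohomology vanishing on the punctured spectrum: sections of
   R / I over the open sets g s != 0 that agree on overlaps come from R. *)
Lemma glue_sections I x y (h : S -> R) (M : nat) :
  is_ideal I -> nzd_mod I x -> nzd_mod (adjoin I x) y ->
  rad (gen_fam g) x -> rad (gen_fam g) y ->
  (forall s u, I ((g s * g u) ^+ M * (h s - h u))) ->
  exists w, forall s, I (g s ^+ M * (w - h s)).
Proof.
move=> idI Ix Iy /(rad_gen_fam_exp M)[a [b xb]] /(rad_gen_fam_exp M)[c [d yd]] hM.
(* With [x ^+ a] written through the [g s ^+ M], [v] glues the sections [x ^+ a * h s]. *)
pose v := \sum_s b s * g s ^+ M * h s.
have vE u : I (g u ^+ M * (v - x ^+ a * h u)).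
  rewrite xb mulr_suml -sumrB mulr_sumr; apply: ideal_big_sum => // s _.
  have -> : g u ^+ M * (b s * g s ^+ M * h s - b s * g s ^+ M * h u) =
    b s * ((g s * g u) ^+ M * (h s - h u)) by rewrite exprMn; ring.
  exact: ideal_mull.
have idJ := ideal_adjoin (x ^+ a) idI.
have Jy : nzd_mod (adjoin I (x ^+ a)) (y ^+ c).
  by apply: nzd_mod_exp; apply: nzd_adjoin_exp.
(* [y ^+ c * v] is a combination of the [g s ^+ M * v], which are multiples of [x ^+ a] modulo [I];
   regularity of [y] makes [v] itself such a multiple. *)
have [w Iw] : adjoin I (x ^+ a) v.
  apply: Jy; rewrite yd mulr_suml; apply: ideal_big_sum => // s _.
  rewrite -mulrA; apply: ideal_mull => //; exists (g s ^+ M * h s).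
  have -> : g s ^+ M * v - g s ^+ M * h s * x ^+ a =
    g s ^+ M * (v - x ^+ a * h s) by ring.
  exact: vE.
exists w => s; apply: (nzd_mod_exp (n := a) Ix).
have -> : x ^+ a * (g s ^+ M * (w - h s)) =
  g s ^+ M * (v - x ^+ a * h s) - g s ^+ M * (v - w * x ^+ a) by ring.
by apply: ideal_sub => //; apply: ideal_mull.
Qed.

Local Notation zeroI := (fun r : R => r = 0).

Lemma ideal_zero : is_ideal zeroI.
Proof.
split=> //; split=> [a b -> ->|r a ->]; first exact: addr0.
exact: mulr0.
Qed.

(* Degree-1 vanishing for Cech cocycles without denominators. *)
Lemma split_cocycle x y z (c : S -> S -> R) (M : nat) :
  nzd_mod zeroI x -> nzd_mod (adjoin zeroI x) y ->
  nzd_mod (adjoin (adjoin zeroI x) y) z ->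
  rad (gen_fam g) x -> rad (gen_fam g) y -> rad (gen_fam g) z ->
  (forall s u t, (g s * g u * g t) ^+ M * (c s u + c u t - c s t) = 0) ->
  exists f, forall s u, g u ^+ (M + M) * f s - g s ^+ (M + M) * f u =
    c s u * (g s ^+ (M + M) * g u ^+ (M + M)).
Proof.
move=> Ix Iy Iz rx ry rz cM; have idI := ideal_zero.
have [a [b xb]] := rad_gen_fam_exp M rx.
(* Contracting with the partition of [x ^+ a] makes [x ^+ a * c] the coboundary of [h], up to a
   power of [g s * g u]. Hence the [h s] agree modulo [x ^+ a] and glue there to [w]. *)
pose h s := \sum_t b t * g t ^+ M * c s t.
have hE s u : (g s * g u) ^+ M * (h s - h u - x ^+ a * c s u) = 0.
  rewrite xb mulr_suml -!sumrB mulr_sumr big1 // => t _.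
  have -> : (g s * g u) ^+ M * (b t * g t ^+ M * c s t - b t * g t ^+ M * c u t
      - b t * g t ^+ M * c s u) =
    - b t * ((g s * g u * g t) ^+ M * (c s u + c u t - c s t)).
    by rewrite !exprMn; ring.
  by rewrite cM mulr0.
have idJ := ideal_adjoin (x ^+ a) idI.
have [|||||| w Jw] := @glue_sections (adjoin zeroI (x ^+ a)) y z h M.
- exact: idJ.
- exact: nzd_adjoin_exp.
- exact: nzd_adjoin2_exp.
- exact: ry.
- exact: rz.
- move=> s u; exists ((g s * g u) ^+ M * c s u).
  by rewrite -(hE s u); ring.
have {Jw}[f fE] := choice Jw.
(* Over [g s ^+ (M + M)] this is the fraction [(h s - w) / x ^+ a], whose differences are [c s u];
   the extra [g s ^+ M] supplies the power of [g s * g u] in [hE]. *)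
exists (fun s => - (g s ^+ M * f s)) => s u.
have xa r : x ^+ a * r = 0 -> r = 0 by apply: (nzd_mod_exp (n := a) Ix).
apply/eqP; rewrite -subr_eq0; apply/eqP/xa; rewrite !exprD.
have e1 : x ^+ a * f s = g s ^+ M * (w - h s).
  by apply/esym/eqP; rewrite -subr_eq0 [_ * f s]mulrC fE.
have e2 : x ^+ a * f u = g u ^+ M * (w - h u).
  by apply/esym/eqP; rewrite -subr_eq0 [_ * f u]mulrC fE.
set gs := g s ^+ M in e1 *; set gu := g u ^+ M in e2 *.
have -> : x ^+ a * (gu * gu * - (gs * f s) - gs * gs * - (gu * f u) -
    c s u * (gs * gs * (gu * gu))) =
  gs * gu * (gs * (x ^+ a * f u) - gu * (x ^+ a * f s) -
    gs * gu * (x ^+ a * c s u)) by ring.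
rewrite e1 e2.
have -> : gs * gu * (gs * (gu * (w - h u)) - gu * (gs * (w - h s)) -
    gs * gu * (x ^+ a * c s u)) =
  gs * gu * ((gs * gu) * (h s - h u - x ^+ a * c s u)) by ring.
by rewrite /gs /gu -exprMn hE mulr0.
Qed.

End Gluing.

(** * Graded algebras *)

Section Grading.
Variables (k : fieldType) (R : comAlgType k) (Rg : nat -> R -> Prop).
Hypothesis grR : std_graded Rg.
Implicit Types (a r : R) (P : R -> Prop).

Local Notation mm := (irrelevant_ideal Rg).

Lemma gr_opp i a : Rg i a -> Rg i (- a).
Proof. by rewrite -scaleN1r; apply: gr_scale. Qed.

Lemma gr_sub i a b : Rg i a -> Rg i b -> Rg i (a - b).
Proof. by move=> Ra Rb; apply: gr_add => //; apply: gr_opp. Qed.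

Lemma gr_sum i (T : Type) (s : seq T) (Q : pred T) (F : T -> R) :
  (forall t, Q t -> Rg i (F t)) -> Rg i (\sum_(t <- s | Q t) F t).
Proof. by move=> RF; apply: big_ind => //; [apply: gr_zero|apply: gr_add]. Qed.

Lemma gr_one : Rg 0 1.
Proof. by apply/(gr_deg0 grR); exists 1; rewrite scale1r. Qed.

Lemma gr_exp d n a : Rg d a -> Rg (d * n) (a ^+ n).
Proof.
move=> Ra; elim: n => [|n IHn]; first by rewrite muln0; apply: gr_one.
by rewrite exprS mulnS; apply: gr_mul.
Qed.

Lemma gr_prod (T : Type) (s : seq T) (d : nat) (F : T -> R) :
  (forall t, Rg d (F t)) -> Rg (d * size s) (\prod_(t <- s) F t).
Proof.
move=> RF; elim: s => [|t s IHs]; first by rewrite big_nil muln0; apply: gr_one.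
by rewrite big_cons mulnS; apply: gr_mul.
Qed.

(** With a decomposition coded as a polynomial whose value at 1 is [r], decompositions multiply as
    polynomials ([gdecM]). *)
Lemma gdec_exists r :
  exists f : {poly R}, (forall i, Rg i f`_i) /\ f.[1] = r.
Proof.
have [N [f [Rf ->]]] := gr_span grR r.
exists (\poly_(i < N) f i); split=> [i|].
  by rewrite coef_poly; case: ifP => // _; apply: gr_zero.
by rewrite horner_poly; apply: eq_bigr => i _; rewrite expr1n mulr1.
Qed.

(* The homogeneous components of r, as the coefficients of a polynomial. *)
Definition gdec r : {poly R} := sval (cid (gdec_exists r)).

Lemma gdec_mem r i : Rg i (gdec r)`_i.
Proof. by rewrite /gdec; case: cid => f []. Qed.

Lemma gdec1 r : (gdec r).[1] = r.
Proof. by rewrite /gdec; case: cid => f []. Qed.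

Lemma gdec_uniq (f : {poly R}) r :
  (forall i, Rg i f`_i) -> f.[1] = r -> gdec r = f.
Proof.
move=> Rf fr; pose N := maxn (size (gdec r)) (size f).
have h1 (g : {poly R}) : (size g <= N)%N -> g.[1] = \sum_(i < N) g`_i.
  move=> gN; rewrite (horner_coef_wide _ gN).
  by apply: eq_bigr => i _; rewrite expr1n mulr1.
apply/polyP => i; have [ltiN|leNi] := ltnP i N; last first.
  by rewrite !nth_default // (leq_trans _ leNi) ?leq_maxl ?leq_maxr.
apply/eqP; rewrite -subr_eq0; apply/eqP.
apply: (gr_indep grR (N := N) (f := fun i => (gdec r)`_i - f`_i)) => //.
  by move=> j; apply: gr_sub; first exact: gdec_mem.
by rewrite sumrB -!h1 ?leq_maxl ?leq_maxr // gdec1 fr subrr.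
Qed.

Lemma gdecD a b : gdec (a + b) = gdec a + gdec b.
Proof.
apply: gdec_uniq => [i|]; last by rewrite hornerD !gdec1.
by rewrite coefD; apply: gr_add => //; apply: gdec_mem.
Qed.

Lemma gdecM a b : gdec (a * b) = gdec a * gdec b.
Proof.
apply: gdec_uniq => [i|]; last by rewrite hornerM !gdec1.
rewrite coefM; apply: gr_sum => j _.
by rewrite -{1}(subnKC (leq_ord j)); apply: gr_mul => //; apply: gdec_mem.
Qed.

Lemma gdec_homog d a : Rg d a -> gdec a = a *: 'X^d.
Proof.
move=> Ra; apply: gdec_uniq => [i|].
  rewrite coefZ coefXn; case: eqP => [->|_]; first by rewrite mulr1.
  by rewrite mulr0; apply: gr_zero.
by rewrite hornerZ hornerXn expr1n mulr1.
Qed.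

Definition comp d r := (gdec r)`_d.

Lemma comp_mem d r : Rg d (comp d r).
Proof. exact: gdec_mem. Qed.

Lemma compD d a b : comp d (a + b) = comp d a + comp d b.
Proof. by rewrite /comp gdecD coefD. Qed.

Lemma comp0 d : comp d 0 = 0.
Proof. by apply: (@addrI _ (comp d 0)); rewrite -compD !addr0. Qed.

Lemma comp_sum d (T : Type) (s : seq T) (Q : pred T) (F : T -> R) :
  comp d (\sum_(t <- s | Q t) F t) = \sum_(t <- s | Q t) comp d (F t).
Proof. by apply: (big_morph (comp d)) => [a b|]; [exact: compD|exact: comp0]. Qed.

Lemma compB d a b : comp d (a - b) = comp d a - comp d b.
Proof.
by apply: (@addIr _ (comp d b)); rewrite -compD !subrK.
Qed.

Lemma comp_id d a : Rg d a -> comp d a = a.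
Proof. by move=> Ra; rewrite /comp (gdec_homog Ra) coefZ coefXn eqxx mulr1. Qed.

Lemma comp_mull e d a r : Rg e a -> comp (e + d) (a * r) = a * comp d r.
Proof.
move=> Ra; rewrite /comp gdecM (gdec_homog Ra) -scalerAl coefZ coefXnM.
by rewrite ltnNge leq_addr /= addKn.
Qed.

Lemma comp_mulr e d a r : Rg e a -> comp (d + e) (r * a) = comp d r * a.
Proof. by move=> Ra; rewrite addnC mulrC (comp_mull _ _ Ra) mulrC. Qed.

Lemma sum_comp r : r = \sum_(i < size (gdec r)) comp i r.
Proof.
rewrite -{1}(gdec1 r) horner_coef.
by apply: eq_bigr => i _; rewrite expr1n mulr1.
Qed.

Lemma irrelevantE r : mm r <-> comp 0 r = 0.
Proof.
split=> [[N [f [Rf [f0 ->]]]]|r0]; last first.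
  exists (size (gdec r)), (fun i => comp i r).
  split; first by move=> i; apply: comp_mem.
  by split; last exact: sum_comp.
rewrite comp_sum big1 // => -[[|i] /= _] _; first by rewrite f0 comp0.
rewrite /comp (gdec_homog (Rf i.+1)) coefZ coefXn mulr0 //.
Qed.

Lemma comp0M a b : comp 0 (a * b) = comp 0 a * comp 0 b.
Proof. by rewrite /comp gdecM coef0M. Qed.

Lemma comp0_exp a n : comp 0 (a ^+ n) = comp 0 a ^+ n.
Proof.
elim: n => [|n IHn]; first by rewrite !expr0 comp_id //; apply: gr_one.
by rewrite !exprS comp0M IHn.
Qed.

Lemma comp0_const a : exists c : k, comp 0 a = c%:A.
Proof. exact/(gr_deg0 grR)/comp_mem. Qed.

Lemma irrelevant_ideal_ideal : is_ideal mm.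
Proof.
split; first by apply/irrelevantE; exact: comp0.
split=> [a b /irrelevantE a0 /irrelevantE b0|r a /irrelevantE a0].
  by apply/irrelevantE; rewrite compD a0 b0 addr0.
by apply/irrelevantE; rewrite comp0M a0 mulr0.
Qed.

Lemma scale1_eq0 (c : k) : (c%:A == 0 :> R) = (c == 0).
Proof. by rewrite scaler_eq0 oner_eq0 orbF. Qed.

(** The quotient by the irrelevant ideal is the field [k], which is reduced. *)
Lemma rad_irrelevant r : rad mm r -> mm r.
Proof.
case=> n /irrelevantE; rewrite comp0_exp => cn; apply/irrelevantE.
have [c cE] := comp0_const r; move: cn; rewrite cE exprZn expr1n => /eqP.
by rewrite scale1_eq0 expf_eq0 => /andP[_ /eqP->]; rewrite scale0r.
Qed.

Lemma prime_const P (c : k) : is_prime_ideal P -> P c%:A -> c = 0.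
Proof.
case=> [idP [P1 _]] Pc; apply: contra_notP P1 => /eqP c0.
rewrite -(scale1r 1) -(mulVf c0) -scalerA -[c *: 1]mul1r scalerAl.
exact: ideal_mull.
Qed.

(* The preimage of P[T] under gdec : R -> R[T] is a prime contained in P. *)
Lemma minimal_prime_homog P r d :
  is_minimal_prime P -> P r -> P (comp d r).
Proof.
move=> [[idP [P1 PM]] minP] Pr; move: d.
pose Q a := forall d, P (comp d a).
apply: (minP Q) => //; last first.
  by move=> a Qa; rewrite (sum_comp a); apply: ideal_big_sum => // i _; apply: Qa.
split.
  split; first by move=> d; rewrite comp0; case: idP.
  split=> [a b Qa Qb d|a b Qb d]; first by rewrite compD; apply: ideal_add.
  rewrite /comp gdecM coefM; apply: ideal_big_sum => // j _.
  by apply: ideal_mull => //; apply: Qb.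
split; first by move=> /(_ 0%N); rewrite comp_id //; apply: gr_one.
move=> a b Qab; apply: contrapT; rewrite not_orP => -[nQa nQb].
have ex c : ~ Q c -> exists d, `[< ~ P (comp d c) >].
  by move=> /existsNP[d nP]; exists d; apply/asboolP.
(* Take the lowest components of [a] and [b] outside [P]: in degree [i + j] of [a * b], every other
   term has a factor in [P]. *)
case: (ex_minnP (ex _ nQa)) => i /asboolP nPi mini.
case: (ex_minnP (ex _ nQb)) => j /asboolP nPj minj.
have := Qab (i + j)%N; rewrite /comp gdecM coefM.
have lti : (i < (i + j).+1)%N by rewrite ltnS leq_addr.
rewrite (bigD1 (Ordinal lti)) //= addKn => Psum.
suff : P (comp i a * comp j b) by case/PM.
rewrite -[_ * _](addrK (\sum_(l < (i + j).+1 | l != Ordinal lti)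
   (gdec a)`_l * (gdec b)`_(i + j - l))); apply: ideal_sub => //.
apply: ideal_big_sum => // l neq_li.
have [lt_li|le_il] := ltnP l i.
  apply: ideal_mulr => //; apply: contrapT => nP.
  by have := mini l (asboolT nP); rewrite leqNgt lt_li.
have {neq_li le_il}lt_il : (i < l)%N by rewrite ltn_neqAle le_il andbT eq_sym.
apply: ideal_mull => //; apply: contrapT => nP.
have := minj _ (asboolT nP); rewrite leqNgt => /negP; apply.
by rewrite ltn_subLR ?ltn_add2r // -ltnS.
Qed.

(** By homogeneity [P] contains the degree 0 component, a constant, which must then be zero. *)
Lemma minimal_prime_sub_irrelevant P r : is_minimal_prime P -> P r -> mm r.
Proof.
move=> mP Pr; apply/irrelevantE; have [c cE] := comp0_const r.
have : P c%:A by rewrite -cE; apply: minimal_prime_homog.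
by move=> /(prime_const (proj1 mP)) c0; rewrite cE c0 scale0r.
Qed.

(** Elements that are constant modulo the ideal of [x] form a subalgebra containing the generators,
    hence all of [R]; comparing degree 0 shows that the constant of an element of the irrelevant
    ideal is zero. *)
Lemma irrelevant_generated : exists (n : nat) (x : 'I_n -> R),
  (forall i, Rg 1%N (x i)) /\ forall r, mm r -> gen_fam x r.
Proof.
have [n [x [Rx genx]]] := gr_std grR; exists n, x; split=> // r mr.
have idx := ideal_gen_fam x.
have [c gc] : exists c : k, gen_fam x (r - c%:A).
  apply: (genx (fun r => exists c : k, gen_fam x (r - c%:A))); last first.
    by move=> i; exists 0; rewrite scale0r subr0; apply: gen_fam_mem.
  split; first by exists 1; rewrite scale1r subrr; case: idx.
  split=> [a b [c ac] [d bd]|].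
    by exists (c + d); rewrite scalerDl opprD addrACA; apply: ideal_add.
  split=> [a b [c ac] [d bd]|c a [d ad]].
    exists (c * d).
    have -> : a * b - (c * d)%:A = (a - c%:A) * b + c%:A * (b - d%:A).
      by rewrite mulrBl mulrBr addrA subrK -[c%:A * d%:A]scalerAl mul1r scalerA.
    by apply: (ideal_add idx); [exact: (ideal_mulr _ idx ac)|exact: (ideal_mull _ idx bd)].
  exists (c * d); rewrite -scalerA -scalerBr -[_ - _]mul1r scalerAl.
  exact: ideal_mull.
suff c0 : c = 0 by move: gc; rewrite c0 scale0r subr0.
have : mm (r - c%:A).
  apply: (gen_fam_min irrelevant_ideal_ideal _ gc) => i; apply/irrelevantE.
  by rewrite /comp (gdec_homog (Rx i)) coefZ coefXn mulr0.
move/irrelevantE; rewrite compB; move/irrelevantE: mr => ->.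
rewrite comp_id; last by apply/(gr_deg0 grR); exists c.
by move/eqP; rewrite sub0r oppr_eq0 scale1_eq0 => /eqP.
Qed.

End Grading.

(** * Separably closed fields *)

Lemma deriv_eq0_comp (k : fieldType) (f : {poly k}) : (1 < size f)%N ->
  f^`() = 0 -> exists2 p, p \in [pchar k] & exists g, f = g \Po 'X^p.
Proof.
move=> f1 f'0; have cf i : f`_i.+1 *+ i.+1 = 0 by rewrite -coef_deriv f'0 coef0.
have ef : (size f).-1 = (size f).-2.+1 by case: (size f) f1 => [|[]].
(* As the derivative has no leading term, the degree of [f] vanishes in [k], which produces the
   characteristic [p]. *)
have [| |p charp] := @natf0_pchar k (size f).-1; first by rewrite ef.
  have := cf (size f).-2; rewrite -ef => /eqP.
  rewrite -[X in X == _ -> _]mulr_natr mulf_eq0 -lead_coefE lead_coef_eq0 => /orP[/eqP f0|//].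
  by rewrite f0 size_poly0 in f1.
exists p => //; have p_gt0 := prime_gt0 (pcharf_prime charp).
exists (\poly_(i < size f) f`_(i * p)); apply/polyP => i.
rewrite coef_comp_poly_Xn //; case: ifP => [p_i|/negP p_i].
  rewrite coef_poly divnK //; case: ltnP => // le_f.
  by rewrite nth_default // (leq_trans le_f) ?leq_div.
case: i p_i => [|i] p_i; first by rewrite dvdn0 in p_i.
apply/eqP; have /eqP := cf i; rewrite -mulr_natr mulf_eq0 => /orP[//|].
by rewrite -(dvdn_pcharf charp) => /p_i.
Qed.

Lemma dvdp_XnsubC_exp (k : fieldType) (q n : nat) (m : k) :
  'X^q - m%:P %| 'X^(q * n) - (m ^+ n)%:P.
Proof. by rewrite exprM polyC_exp subrXX dvdp_mulr. Qed.

Lemma dvdp_prod_XnsubC_exp (k : fieldType) (q n : nat) (s : seq k) :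
  \prod_(m <- s) ('X^q - m%:P) %|
    \prod_(m <- [seq m ^+ n | m <- s]) ('X^(q * n) - m%:P).
Proof.
elim: s => [|m s IHs]; first by rewrite !big_nil dvdpp.
by rewrite /= !big_cons dvdp_mul // dvdp_XnsubC_exp.
Qed.

(** Each root of [f] has its [q]-th power in [k], where [q] is 1 in characteristic zero and a power
    of the characteristic otherwise. Induction on the size: a separable [f] has a root in [k]; an
    [f] with zero derivative is a polynomial in ['X^p]; otherwise the gcd of [f] with its derivative
    is a proper factor. *)
Lemma separably_closed_dvd (k : fieldType) (f : {poly k}) :
  separably_closed k -> f != 0 -> exists (q : nat) (s : seq k),
    [pchar k].-nat q /\ f %| \prod_(m <- s) ('X^q - m%:P).
Proof.
move=> sepk; have [n] := ubnP (size f); elim: n f => // n IHn f ltfn f0.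
have [f1|f1] := leqP (size f) 1.
  by exists 1%N, [::]; split=> //; rewrite big_nil dvdp1 eqn_leq f1 size_poly_gt0.
have [/(sepk _ f1)[a /factor_theorem[g fE]]|nsep] := boolP (separable_poly f).
  have g0 : g != 0 by apply: contraNneq f0 => g0; rewrite fE g0 mul0r.
  have [|q [s [qk gs]]] := IHn g _ g0.
    rewrite -ltnS (leq_trans _ ltfn) // fE size_Mmonic ?monicXsubC //.
    by rewrite size_XsubC addn2.
  exists q, (a ^+ q :: s); split=> //; rewrite big_cons fE mulrC dvdp_mul //.
  by have := dvdp_XnsubC_exp 1 q a; rewrite mul1n expr1.
have [f'0|f'0] := eqVneq f^`() 0.
  have [p charp [g fE]] := deriv_eq0_comp f1 f'0.
  have p_gt1 := prime_gt1 (pcharf_prime charp).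
  have g0 : g != 0 by apply: contraNneq f0 => g0; rewrite fE g0 comp_poly0.
  have szf : (size f).-1 = ((size g).-1 * p)%N.
    by rewrite fE size_comp_poly size_polyXn.
  have [|q [s [qk gs]]] := IHn g _ g0.
    rewrite -ltnS (leq_trans _ ltfn) // ltnS.
    have : (0 < size g)%N by rewrite size_poly_gt0.
    have : (0 < (size f).-1)%N by case: (size f) f1 => [|[]].
    rewrite szf muln_gt0 => /andP[g_gt0 _] _.
    rewrite -(ltn_predK f1) szf -{1}(prednK (n := size g)) ?size_poly_gt0 //.
    by rewrite ltnS ltn_Pmulr.
  exists (p * q)%N, s; split.
    by rewrite pnatM qk andbT pnatE ?(pcharf_prime charp).
  apply: (dvdp_trans (_ : f %| (\prod_(m <- s) ('X^q - m%:P)) \Po 'X^p)).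
    by rewrite fE dvdp_comp_poly.
  rewrite rmorph_prod (eq_bigr (fun m => 'X^(p * q) - m%:P)) // => m _.
  by rewrite /= rmorphB /= comp_Xn_poly comp_polyC exprM.
pose d := gcdp f f^`(); have d0 : d != 0 by rewrite gcdp_eq0 (negPf f0).
have fE : f = (f %/ d) * d by rewrite divpK // dvdp_gcdl.
have e0 : f %/ d != 0 by apply: contraNneq f0 => e0; rewrite fE e0 mul0r.
have ltdf : (size d < size f)%N.
  by rewrite (leq_ltn_trans (dvdp_leq f'0 (dvdp_gcdr _ _))) // lt_size_deriv.
have d1 : (1 < size d)%N.
  rewrite ltn_neqAle size_poly_gt0 d0 andbT eq_sym.
  by apply: contra nsep => szd; rewrite unlock /coprimep.
have ltef : (size (f %/ d)%R < size f)%N.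
  rewrite {2}fE size_mul // -ltnS (ltn_predK (m := 0)); last first.
    by rewrite addn_gt0 size_poly_gt0 e0.
  by rewrite -[X in (X < _)%N]addn1 ltn_add2l.
have [|q [s [qk ds]]] := IHn d _ d0; first exact: leq_trans ltdf _.
have [|q' [s' [qk' es]]] := IHn _ _ e0; first exact: leq_trans ltef _.
exists (q * q')%N, ([seq m ^+ q' | m <- s] ++ [seq m ^+ q | m <- s']).
split; first by rewrite pnatM qk.
rewrite big_cat {1}fE mulrC /= dvdp_mul //.
  exact: dvdp_trans ds (dvdp_prod_XnsubC_exp _ _ _).
by rewrite mulnC; apply: dvdp_trans es (dvdp_prod_XnsubC_exp _ _ _).
Qed.

Lemma ideal_scale (k : fieldType) (R : comAlgType k) (I : R -> Prop) c r :
  is_ideal I -> I r -> I (c *: r).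
Proof. by move=> idI Ir; rewrite -[r]mul1r scalerAl; apply: ideal_mull. Qed.

(** * Fractions modulo a prime as eigenvalues of matrices *)

Section EigenRelation.
Variables (k : fieldType) (R : comAlgType k) (P : R -> Prop).
Hypothesis prP : is_prime_ideal P.
Variables (n : nat) (v : 'I_n.+1 -> R).

Let idP : is_ideal P := proj1 prP.

(* Modulo P, the fraction y / z acts on the vector v by the matrix C. *)
Definition acts_by (y z : R) (C : 'M[k]_n.+1) :=
  forall a, P (y * v a - z * \sum_b C a b *: v b).

Lemma acts_by1 : acts_by 1 1 1.
Proof.
move=> a; rewrite (bigD1 a) //= mxE eqxx scale1r big1 ?addr0; last first.
  by move=> b /negPf ab; rewrite mxE eq_sym ab scale0r.
by rewrite subrr; case: idP.
Qed.

Lemma acts_by0 y z : acts_by y z 0 -> forall a, P (y * v a).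
Proof.
move=> y0 a; have := y0 a; rewrite big1 ?mulr0 ?subr0 // => b _.
by rewrite mxE scale0r.
Qed.

Lemma acts_byM y z C y' z' C' :
  acts_by y z C -> acts_by y' z' C' -> acts_by (y * y') (z * z') (C * C').
Proof.
move=> yC yC' a.
have -> : \sum_b (C * C') a b *: v b =
    \sum_b C a b *: (\sum_c C' b c *: v c).
  under eq_bigr => b _ do rewrite mxE scaler_suml.
  rewrite exchange_big; apply: eq_bigr => b _ /=.
  by rewrite scaler_sumr; apply: eq_bigr => c _; rewrite scalerA.
set w := fun b => \sum_c C' b c *: v c.
have sumE : \sum_b C a b *: (y' * v b - z' * w b) =
    y' * (\sum_b C a b *: v b) - z' * (\sum_b C a b *: w b).
  rewrite !mulr_sumr -sumrB; apply: eq_bigr => b _.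
  by rewrite scalerBr -!scalerAr.
have -> : y * y' * v a - z * z' * \sum_b C a b *: w b =
    y' * (y * v a - z * \sum_b C a b *: v b) +
    z * \sum_b C a b *: (y' * v b - z' * w b) by rewrite sumE; ring.
apply: (ideal_add idP); apply: (ideal_mull _ idP) => //.
by apply: ideal_big_sum => // b _; apply: ideal_scale => //; apply: yC'.
Qed.

Lemma acts_by_exp y z C q :
  acts_by y z C -> acts_by (y ^+ q) (z ^+ q) (C ^+ q).
Proof.
move=> yC; elim: q => [|q IHq]; first exact: acts_by1.
by rewrite !exprS; apply: acts_byM.
Qed.

Lemma acts_by_subC y z C m :
  acts_by y z C -> acts_by (y - m *: z) z (C - m%:M).
Proof.
move=> yC a.
have -> : \sum_b (C - m%:M) a b *: v b = \sum_b C a b *: v b - m *: v a.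
  rewrite (eq_bigr (fun b => C a b *: v b - (m *+ (a == b)) *: v b)); last first.
    by move=> b _; rewrite !mxE scalerBl.
  rewrite sumrB; congr (_ - _); rewrite (bigD1 a) //= eqxx big1 ?addr0 //.
  by move=> b /negPf ab; rewrite eq_sym ab scale0r.
have -> : (y - m *: z) * v a - z * (\sum_b C a b *: v b - m *: v a) =
    y * v a - z * \sum_b C a b *: v b.
  by rewrite mulrBl mulrBr -scalerAl -scalerAr; ring.
exact: yC.
Qed.

Lemma acts_by_prod y z C q (s : seq k) : acts_by y z C ->
  acts_by (\prod_(m <- s) (y ^+ q - m *: z ^+ q)) (\prod_(m <- s) z ^+ q)
    (horner_mx C (\prod_(m <- s) ('X^q - m%:P))).
Proof.
move=> yC; elim: s => [|m s IHs].
  by rewrite !big_nil rmorph1; apply: acts_by1.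
rewrite !big_cons rmorphM; apply: acts_byM => //.
rewrite rmorphB rmorphXn /= horner_mx_X horner_mx_C.
by apply: acts_by_subC; apply: acts_by_exp.
Qed.

(* Cayley-Hamilton makes y / z algebraic over k modulo P, hence purely
   inseparable when k is separably closed. *)
Lemma acts_by_purely_inseparable y z C : separably_closed k ->
  (exists a, ~ P (v a)) -> acts_by y z C ->
  exists q m, [pchar k].-nat q /\ P (y ^+ q - m *: z ^+ q).
Proof.
move=> sepk [a nPa] yC.
have [q [s [qk /dvdpP[g gE]]]] :=
  separably_closed_dvd sepk (monic_neq0 (char_poly_monic C)).
(* A multiple of the characteristic polynomial vanishes at [C], so the product of the
   [y ^+ q - m *: z ^+ q] kills [v a] modulo [P], and one factor lies in [P]. *)
have := acts_by_prod q s yC; rewrite gE rmorphM [X in _ * X](Cayley_Hamilton C) mulr0.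
move=> /acts_by0/(_ a); case: (prP) => _ [_ PM] /PM[Pprod|//].
by have [m Pm] := prime_prod prP Pprod; exists q, m.
Qed.

End EigenRelation.

(** * Simplicial cochains *)

Section Duality.
Variables (k : fieldType) (n : nat).
Implicit Types (c a e : {set 'I_n} -> k) (F G : {set 'I_n}).

Definition cobdry a F : k :=
  \sum_(v in F) (-1) ^+ #|[set w in F :\ v | (w < v)%N]| * a (F :\ v).

Lemma bdry_pairing c a : \sum_G bdry c G * a G = \sum_F c F * cobdry a F.
Proof.
transitivity (\sum_(v : 'I_n) \sum_(G : {set 'I_n} | v \notin G)
    (-1) ^+ #|[set w in G | (w < v)%N]| * c (v |: G) * a G).
  under eq_bigr => G _ do rewrite mulr_suml.
  by rewrite (exchange_big_dep xpredT).
under [RHS]eq_bigr => F _ do rewrite mulr_sumr.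
rewrite [RHS](exchange_big_dep xpredT) //=; apply: eq_bigr => v _.
rewrite (reindex_onto (fun F => F :\ v) (fun G => v |: G)) /=; last first.
  by move=> G vG; rewrite setU1K.
apply: eq_big => [F|F /andP[_ /eqP ->]]; last by ring.
apply/andP/idP => [[_ /eqP <-]|vF]; first exact: setU11.
by rewrite setD11 setD1K.
Qed.

Lemma cobdry1 a v w : v != w -> cobdry a [set v; w] =
  if (v < w)%N then a [set w] - a [set v] else a [set v] - a [set w].
Proof.
wlog lt_vw : v w / (v < w)%N => [hw|] neq_vw.
  have [lt_vw|le_wv] := ltnP v w; first by rewrite hw // lt_vw.
  have lt_wv : (w < v)%N by rewrite ltn_neqAle le_wv andbT eq_sym.
  by rewrite setUC hw 1?eq_sym // lt_wv.
have Dv : [set v; w] :\ v = [set w] by rewrite setU1K // inE.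
have Dw : [set v; w] :\ w = [set v] by rewrite setUC setU1K // inE eq_sym.
rewrite /cobdry (big_setD1 v) ?inE ?eqxx //= Dv big_set1 Dw lt_vw.
rewrite (eqP (_ : #|_| == 0)); last first.
  rewrite cards_eq0; apply/eqP/setP => u; rewrite !inE.
  by case: eqP => // ->; rewrite ltnNge ltnW.
rewrite (_ : [set u in [set v] | _] = [set v]); last first.
  by apply/setP => u; rewrite !inE; case: eqP => // ->; rewrite lt_vw.
by rewrite cards1 expr0 mul1r expr1 mulN1r.
Qed.

Lemma cobdry2 a (i j l : 'I_n) : (i < j)%N -> (j < l)%N ->
  cobdry a [set i; j; l] = a [set j; l] - a [set i; l] + a [set i; j].
Proof.
move=> ij jl; have il := ltn_trans ij jl.
have nij : i != j by rewrite -val_eqE /= ltn_eqF.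
have njl : j != l by rewrite -val_eqE /= ltn_eqF.
have nil : i != l by rewrite -val_eqE /= ltn_eqF.
have Di : [set i; j; l] :\ i = [set j; l].
  by rewrite -setUA setU1K // !inE negb_or nij.
have Dj : [set i; j; l] :\ j = [set i; l].
  by rewrite (setUC [set i]) -setUA setU1K // !inE negb_or eq_sym nij.
have Dl : [set i; j; l] :\ l = [set i; j].
  by rewrite setUC setU1K // !inE negb_or !(eq_sym l) nil.
rewrite /cobdry (big_setD1 i) ?inE ?eqxx //= Di (big_setD1 j) ?inE ?eqxx //=.
rewrite setU1K ?inE // big_set1 Dj Dl.
have -> : [set w in [set j; l] | (w < i)%N] = set0.
  apply/setP => u; rewrite !inE; apply/andP => -[/orP[]/eqP->]; rewrite ltnNge ltnW //.
have -> : [set w in [set i; l] | (w < j)%N] = [set i].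
  apply/setP => u; rewrite !inE.
  by do 2!case: eqP => [->|_] //=; rewrite ltnNge ltnW.
have -> : [set w in [set i; j] | (w < l)%N] = [set i; j].
  by apply/setP => u; rewrite !inE; do 2!case: eqP => [->|_] //=; rewrite ?il ?jl.
by rewrite cards0 cards1 cards2 nij expr0 expr1 sqrrN expr1n !mul1r mulN1r addrA.
Qed.

Let delta F : {set 'I_n} -> k := fun G => (G == F)%:R.

Lemma bdry_delta e G : bdry e G = \sum_F e F * bdry (delta F) G.
Proof.
rewrite /bdry; under [RHS]eq_bigr => F _ do rewrite mulr_sumr.
rewrite exchange_big; apply: eq_bigr => v _ /=.
rewrite (bigD1 (v |: G)) //= /delta eqxx big1 ?addr0 => [|F /negPf FE].
  by rewrite mulr1 mulrC.
by rewrite eq_sym FE !mulr0.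
Qed.

Lemma cobdry_delta a F : cobdry a F = \sum_G bdry (delta F) G * a G.
Proof.
rewrite bdry_pairing (bigD1 F) //= /delta eqxx mul1r big1 ?addr0 // => G.
by move=> /negPf->; rewrite mul0r.
Qed.

(** Linear duality: a vector outside the row space of the boundary matrix is detected by a column of
    its cokernel, and such a column is a cocycle. *)
Lemma chain_bounds (face : {set 'I_n} -> Prop) d c :
  (forall a, (forall F, face F -> #|F| = d.+1 -> cobdry a F = 0) ->
     \sum_G c G * a G = 0) ->
  exists e, chain_supp face d.+1 e /\ forall F, bdry e F = c F.
Proof.
move=> c_ann; pose good F := `[< face F /\ #|F| = d.+1 >].
pose T : finType := {set 'I_n}.
(* Rows of all sets but the faces with [d.+1] vertices are zero, so the row space consists of the
   boundaries of chains of the complex. *)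
pose M : 'M[k]_#|T| := \matrix_(i, j)
  if good (enum_val i) then bdry (delta (enum_val i)) (enum_val j) else 0.
pose u : 'rV[k]_#|T| := \row_j c (enum_val j).
have sumE (V : zmodType) (f : T -> V) : \sum_F f F = \sum_(i < #|T|) f (enum_val i).
  exact: (reindex _ (onW_bij _ (enum_val_bij _))).
have [/submxP[D uE]|] := boolP (u <= M)%MS.
  exists (fun F => if good F then D 0 (enum_rank F) else 0); split=> [F|F].
    by case: ifP => [/asboolP//|]; rewrite eqxx.
  have := congr1 (fun A : 'rV_#|T| => A 0 (enum_rank F)) uE.
  rewrite !mxE enum_rankK => ->; rewrite bdry_delta sumE; apply: eq_bigr => i _.
  by rewrite enum_valK mxE enum_rankK; case: ifP => // _; rewrite mul0r mulr0.
rewrite submxE => nz.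
have [j nzj] : exists j, (u *m cokermx M) 0 j != 0.
  apply/existsP; apply: contraNT nz => /existsPn all0.
  apply/eqP/rowP => j; rewrite [RHS]mxE; apply/eqP.
  by have := all0 j; rewrite negbK.
case/eqP: nzj.
rewrite mxE -[RHS](c_ann (fun G => cokermx M (enum_rank G) j)).
  by rewrite sumE; apply: eq_bigr => i _; rewrite mxE enum_valK.
move=> F faceF cardF; rewrite cobdry_delta sumE.
transitivity ((M *m cokermx M) (enum_rank F) j); last first.
  by rewrite mulmx_coker mxE.
rewrite mxE; apply: eq_bigr => i _.
by rewrite [M _ _]mxE enum_rankK enum_valK (_ : good F) //; apply: asboolT.
Qed.

End Duality.

(** * Monomials and global functions on a component *)

Lemma eventually_all (T : finType) (Q : T -> nat -> Prop) :
  (forall t, exists N0, forall N, (N0 <= N)%N -> Q t N) ->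
  exists N0, forall N, (N0 <= N)%N -> forall t, Q t N.
Proof.
move=> /choice[f fQ]; exists (\max_t f t) => N leN t; apply: fQ.
exact: leq_trans (leq_bigmax t) leN.
Qed.

Section Words.
Variables (k : fieldType) (R : comAlgType k) (Rg : nat -> R -> Prop).
Hypothesis grR : std_graded Rg.
Variables (m : nat) (x : 'I_m -> R).
Hypothesis Rx : forall j, Rg 1 (x j).
Local Notation mm := (irrelevant_ideal Rg).
Hypothesis gen_x : forall r, mm r -> gen_fam x r.

(** Monomials are indexed, with repetitions, by words instead of exponent vectors, so that degree
    [N] corresponds to the finite type [N.-tuple 'I_m]. *)
Definition mon (s : seq 'I_m) : R := \prod_(j <- s) x j.

Lemma gr_mon s : Rg (size s) (mon s).
Proof. by rewrite -[size s]mul1n; apply: gr_prod. Qed.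

Lemma irrelevant_homog d r : Rg d.+1 r -> mm r.
Proof.
move=> Rr; apply/(irrelevantE grR).
by rewrite /comp (gdec_homog grR Rr) coefZ coefXn mulr0.
Qed.

(** Write [r] as a combination of the [x j]; by homogeneity the coefficients can be cut down to one
    degree less, where induction applies. *)
Lemma gr_words_span N r : Rg N r ->
  exists c : N.-tuple 'I_m -> k, r = \sum_w c w *: mon w.
Proof.
pose spn N r := exists c : N.-tuple 'I_m -> k, r = \sum_w c w *: mon w.
have spn0 L : spn L 0.
  by exists (fun=> 0); rewrite big1 // => w _; rewrite scale0r.
have spnD L a b : spn L a -> spn L b -> spn L (a + b).
  move=> [c ->] [d ->]; exists (fun w => c w + d w).
  by rewrite -big_split; apply: eq_bigr => w _; rewrite scalerDl.
have spn_mon L (w : L.-tuple 'I_m) t : spn L (t *: mon w).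
  exists (fun u => t *+ (u == w)); rewrite (bigD1 w) //= eqxx big1 ?addr0 //.
  by move=> u /negPf->; rewrite scale0r.
elim: N r => [|N IHN] r.
  move=> /(gr_deg0 grR)[t ->]; have := spn_mon _ [tuple] t.
  by rewrite /mon big_nil.
move=> Rr; have [a rE] := gen_x (irrelevant_homog Rr).
rewrite -(comp_id grR Rr) rE comp_sum.
apply: (big_ind (spn N.+1)) => [|b c|j _]; [exact: spn0|exact: spnD|].
rewrite -addn1 (comp_mulr grR) // addn1.
have [c ->] := IHN _ (comp_mem grR N (a j)).
rewrite mulr_suml; apply: (big_ind (spn N.+1)) => [|b d|w _]; [exact: spn0|exact: spnD|].
have -> : c w *: mon w * x j = c w *: mon [tuple of j :: w].
  by rewrite /mon big_cons -scalerAl [x j * _]mulrC.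
exact: spn_mon.
Qed.

(** Pigeonhole: among more than [m * B] letters from an alphabet of size [m], one occurs at least
    [B] times. *)
Lemma mon_split (B : nat) (s : seq 'I_m) : (m * B < size s)%N ->
  exists j r, Rg (size s - B) r /\ mon s = r * x j ^+ B.
Proof.
move=> lt_s; have sumE : (\sum_j count_mem j s)%N = size s.
  elim: s {lt_s} => [|i s IHs]; first by rewrite big1.
  rewrite /= -IHs big_split /= (bigD1 i) //= eqxx big1 ?addn0 // => j.
  by rewrite eq_sym => /negPf->.
have [j leB] : exists j, (B <= count_mem j s)%N.
  apply/existsP; apply: contraTT lt_s => /existsPn ltB.
  rewrite -leqNgt -sumE -[X in (_ <= X * _)%N](card_ord m) -sum_nat_const.
  by apply: leq_sum => j _; rewrite ltnW // ltnNge ltB.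
pose t := [seq i <- s | i != j].
have monE : mon s = x j ^+ (count_mem j s) * mon t.
  rewrite /mon /t; elim: s {lt_s sumE leB t} => [|i s IHs].
    by rewrite !big_nil mulr1.
  by rewrite big_cons IHs /=; case: eqP => [->|_];
    rewrite ?big_cons ?exprS /=; ring.
have szE : size s = (count_mem j s + size t)%N.
  by rewrite /t size_filter count_predC.
exists j, (x j ^+ (count_mem j s - B) * mon t); split; last first.
  by rewrite monE -{1}(subnK leB) exprD; ring.
have -> : (size s - B = 1 * (count_mem j s - B) + size t)%N.
  by rewrite szE mul1n addnBAC.
by apply: gr_mul => //; [apply: gr_exp|apply: gr_mon].
Qed.

(* The fraction e s / G s, the same modulo P for all s, multiplies the image
   of R_N in R / P into itself for large N. *)
Lemma fraction_purely_inseparable (S : finType) (A : pred S) (G e : S -> R)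
    (E : nat) (P : R -> Prop) :
  separably_closed k -> is_prime_ideal P -> ~ (forall r, mm r -> P r) ->
  (forall s, Rg E (G s)) -> (forall s, Rg E (e s)) ->
  (forall r, mm r -> rad (gen_fam G) r) ->
  (forall s, ~~ A s -> P (G s)) ->
  (forall s u, A s -> A u -> P (G u * e s - G s * e u)) ->
  exists q mu, [pchar k].-nat q /\
    forall s, A s -> P (e s ^+ q - mu *: G s ^+ q).
Proof.
move=> sepk prP nmP RG Re radG PG PGe; have [idP [_ PM]] := prP.
have [u0 nPu0] : exists u, ~ P (G u).
  apply: contrapT => /forallNP allP; apply: nmP => r /radG[N genr].
  apply: (prime_exp prP (n := N)); apply: (gen_fam_min idP _ genr) => s.
  exact: contrapT (allP s).
have Au0 : A u0 by apply: contrapT => /negP/PG.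
have [j0 nPj0] : exists j, ~ P (x j).
  apply: contrapT => /forallNP allP; apply: nmP => r /gen_x.
  by apply: gen_fam_min => // j; apply: contrapT (allP j).
(* One exponent [B] serves all [j], and homogeneity allows coefficients of degree [B - E]. *)
have [B [leEB genB]] : exists B, (E <= B)%N /\
    forall j, exists b : S -> R, (forall s, Rg (B - E) (b s)) /\
      x j ^+ B = \sum_s b s * G s.
  have [|B0 genB] := @eventually_all 'I_m (fun j B => gen_fam G (x j ^+ B)).
    move=> j; have [B0 genB] := radG _ (irrelevant_homog (Rx j)).
    by exists B0 => B leB; apply: ideal_expW genB => //; apply: ideal_gen_fam.
  exists (maxn E B0); split=> [|j]; first exact: leq_maxl.
  have [b bE] := genB _ (leq_maxr E B0) j.
  exists (fun s => comp grR (maxn E B0 - E) (b s)); split=> [s|].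
    exact: comp_mem.
  have Rxj : Rg (maxn E B0) (x j ^+ maxn E B0).
    by rewrite -{1}[maxn _ _]mul1n; apply: gr_exp.
  rewrite -(comp_id grR Rxj) bE comp_sum; apply: eq_bigr => s _.
  by rewrite -(comp_mulr grR _ _ (RG s)) subnK // leq_maxl.
pose N := (m * B).+1; pose W : finType := (N.-tuple 'I_m)%type.
pose v (a : 'I_#|W|) := mon (enum_val a : N.-tuple 'I_m).
have actv a : exists c : 'I_#|W| -> k,
    P (e u0 * v a - G u0 * \sum_b c b *: v b).
  set w : N.-tuple 'I_m := enum_val a.
  have [|j [r [Rr monE]]] := @mon_split B w; first by rewrite size_tuple.
  rewrite size_tuple in Rr; have [b [Rb xE]] := genB j.
  (* Multiplying [r * x j ^+ B], the sum of the [r * b s * G s], by the fraction turns [G s] into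
     [e s] and keeps the degree [N]; terms outside [A] vanish modulo [P]. *)
  pose f := \sum_(s | A s) r * b s * e s.
  have leBN : (B <= N)%N.
    by rewrite /N ltnW // ltnS leq_pmull // (leq_ltn_trans _ (ltn_ord j0)).
  have Rf : Rg N f.
    apply: gr_sum => // s _; rewrite -(subnK leBN) -{2}(subnK leEB) addnA.
    by apply: gr_mul => //; apply: gr_mul.
  have [c fE] := gr_words_span Rf; exists (fun i => c (enum_val i)).
  have -> : \sum_b0 c (enum_val b0) *: v b0 = f.
    by rewrite fE (reindex _ (onW_bij _ (enum_val_bij W))).
  have -> : e u0 * v a - G u0 * f =
      \sum_s r * b s * (if A s then e u0 * G s - G u0 * e s else e u0 * G s).
    rewrite /v -/w monE xE /f [\sum_(s | A s) _]big_mkcond !mulr_sumr -sumrB.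
    by apply: eq_bigr => s _; case: ifP => _; ring.
  apply: ideal_big_sum => // s _; apply: ideal_mull => //; case: ifP => As.
    by have := PGe u0 s Au0 As; rewrite mulrC [G u0 * _]mulrC.
  by apply: ideal_mull => //; apply: PG; rewrite As.
have nPv : exists a, ~ P (v a).
  exists (enum_rank [tuple of nseq N j0]); rewrite /v enum_rankK /mon => Pmon.
  by apply: nPj0; apply: (prime_exp prP (n := N)); move: Pmon;
    rewrite big_nseq -Monoid.iteropE.
have [q [mu [qk Pe0]]] : exists q mu, [pchar k].-nat q /\
    P (e u0 ^+ q - mu *: G u0 ^+ q).
  have [c cP] := choice actv; move: nPv c cP; move: (v).
  case: #|W| => [v' [[]]//|L v' nPv c cP].
  apply: (acts_by_purely_inseparable prP (v := v') (C := \matrix_(a, b) c a b)) => //.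
  move=> a; have := cP a.
  by under [in X in _ -> X]eq_bigr => b _ do rewrite mxE.
exists q, mu; split=> // s As.
have : P (G u0 ^+ q * (e s ^+ q - mu *: G s ^+ q)).
  have -> : G u0 ^+ q * (e s ^+ q - mu *: G s ^+ q) =
    ((G u0 * e s) ^+ q - (G s * e u0) ^+ q) +
      G s ^+ q * (e u0 ^+ q - mu *: G u0 ^+ q).
    rewrite -[mu *: G s ^+ q]mulr_algl -[mu *: G u0 ^+ q]mulr_algl !exprMn.
    by ring.
  apply: (ideal_add idP); last exact: ideal_mull.
  by rewrite subrXX; apply: ideal_mulr => //; apply: PGe.
by case/PM => // /(prime_exp prP).
Qed.

End Words.

(** * The complex of minimal primes *)

Lemma depth_ge3_regular (R : comNzRingType) (m : R -> Prop) :
  depth_ge m 3 -> exists x y z,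
  [/\ m x, m y & m z] /\
  [/\ nzd_mod (fun r => r = 0) x, nzd_mod (adjoin (fun r => r = 0) x) y &
      nzd_mod (adjoin (adjoin (fun r => r = 0) x) y) z].
Proof.
case=> xs [sz [mxs [reg _]]].
case: xs sz mxs reg => [|x [|y [|z [|? ?]]]] // _ mxs reg.
have gen0 r : gen_ideal [::] r <-> r = 0.
  split=> [[a [_ ->]]|->]; first by rewrite big_ord0.
  by exists [::]; rewrite big_ord0.
have gen1 r : gen_ideal [:: x] r <-> adjoin (fun r => r = 0) x r.
  split=> [[l [sl ->]]|[a ra]].
    by case: l sl => [|a []] // _; exists a; rewrite big_ord_recl big_ord0 addr0 subrr.
  by exists [:: a]; rewrite big_ord_recl big_ord0 addr0 -[r](subrK (a * x)) ra add0r.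
have gen2 r : gen_ideal [:: x; y] r <->
    adjoin (adjoin (fun r => r = 0) x) y r.
  split=> [[l [sl ->]]|[b [a ra]]].
    by case: l sl => [|a [|b []]] // _; exists b, a; rewrite !big_ord_recl big_ord0 /=; ring.
  exists [:: a; b]; split=> //; rewrite !big_ord_recl big_ord0 /=.
  by rewrite addr0 -[r](subrK (b * y)) -[r - _](subrK (a * x)) ra add0r.
exists x, y, z; split; first by split; apply: mxs; rewrite !inE eqxx ?orbT.
split=> r.
- by move=> xr; apply/gen0; apply: (reg 0%N) => //; apply/gen0.
- by move=> /gen1 yr; apply/gen1; apply: (reg 1%N).
- by move=> /gen2 zr; apply/gen2; apply: (reg 2%N).
Qed.

Section Spectrum.
Variables (k : fieldType) (R : comAlgType k) (Rg : nat -> R -> Prop).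
Variables (n : nat) (p : 'I_n -> R -> Prop).
Hypothesis grR : std_graded Rg.
Hypothesis minp : forall i, is_minimal_prime (p i).
Hypothesis allp : forall P : R -> Prop, is_minimal_prime P ->
  exists i, same_set P (p i).
Hypothesis injp : forall i j, same_set (p i) (p j) -> i = j.
Variables x y z : R.
Local Notation mm := (irrelevant_ideal Rg).
Hypotheses (mx : mm x) (my : mm y) (mz : mm z).
Local Notation zeroI := (fun r : R => r = 0).
Hypothesis regx : nzd_mod zeroI x.
Hypothesis regy : nzd_mod (adjoin zeroI x) y.
Hypothesis regz : nzd_mod (adjoin (adjoin zeroI x) y) z.
Implicit Types (F : {set 'I_n}) (r : R).

Let prp i : is_prime_ideal (p i) := proj1 (minp i).
Let idp i : is_ideal (p i) := proj1 (prp i).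

Lemma nilpotent_of_minimal_primes r :
  (forall i, p i r) -> exists N, r ^+ N = 0.
Proof.
move=> pr; apply: contrapT => /forallNP nil.
have [|P [mP nPr]] := @nonnilpotent_minimal_prime R r.
  by move=> N; apply/eqP/nil.
by have [i Pi] := allp mP; apply/nPr/Pi.
Qed.

(** Otherwise every minimal prime would lie in [p i], making [p i] the only one; then [x] would be
    nilpotent, against its regularity. *)
Lemma irrelevant_not_sub_minimal i : ~ (forall r, mm r -> p i r).
Proof.
move=> sub; have [|N xN] := @nilpotent_of_minimal_primes x.
  move=> j; have -> : j = i; last exact: sub.
  apply: injp => r; split=> [|pir].
    by move/(minimal_prime_sub_irrelevant grR (minp j))/sub.
  case: (minp i) => _ /(_ (p j) (prp j)); apply=> // s.
  by move/(minimal_prime_sub_irrelevant grR (minp j))/sub.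
have := @nzd_mod_exp _ _ _ N regx 1.
by rewrite mulr1 xN => /(_ erefl)/eqP; rewrite oner_eq0.
Qed.

Lemma inhabited_minimal_primes : exists i : 'I_n, True.
Proof.
have [|P [mP _]] := @nonnilpotent_minimal_prime R 1.
  by move=> N; rewrite expr1n oner_eq0.
by have [i _] := allp mP; exists i.
Qed.

Lemma rad_ideal_sum_irrelevant F r : rad (ideal_sum p F) r -> mm r.
Proof.
case=> N pr; apply: (rad_irrelevant grR); exists N.
apply: (ideal_sum_sub (irrelevant_ideal_ideal grR) _ pr) => i s _.
exact: minimal_prime_sub_irrelevant.
Qed.

Lemma DeltaE F :
  Delta Rg p F <-> ~ (forall r, mm r -> rad (ideal_sum p F) r).
Proof.
split=> DF sub; apply: DF; last by move=> r /sub.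
by move=> r; split; [exact: rad_ideal_sum_irrelevant|exact: sub].
Qed.

Lemma Delta_sub F F' : F \subset F' -> Delta Rg p F' -> Delta Rg p F.
Proof.
move=> /subsetP sFF' /DeltaE DF'; apply/DeltaE => sub; apply: DF' => r /sub.
apply: rad_mono => s; apply: ideal_sum_sub; first exact: ideal_sum_ideal.
by move=> i t /sFF' iF'; apply: ideal_sum_mem.
Qed.

Lemma Delta1 i : Delta Rg p [set i].
Proof.
apply/DeltaE => sub; apply: (@irrelevant_not_sub_minimal i) => r /sub[N].
move=> /(ideal_sum_sub (idp i)) pr; apply: (prime_exp (prp i) (n := N)).
by apply: pr => j s; rewrite inE => /eqP->.
Qed.

(** Minimal primes being homogeneous, the summands can be cut down to degree [N]. Having all large
    [N] lets one exponent serve every nonface and generator. *)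
Lemma nonface_power F r : ~ Delta Rg p F -> Rg 1 r ->
  exists N0, forall N, (N0 <= N)%N -> exists f : 'I_n -> R,
    (forall i, i \in F -> p i (f i)) /\
    (forall i, Rg N (f i)) /\ r ^+ N = \sum_(i in F) f i.
Proof.
rewrite DeltaE => /contrapT/(_ _ (irrelevant_homog grR _)) sub Rr.
have [N0 pr] := sub _ _ Rr; exists N0 => N /ideal_expW/(_ pr).
case=> [|f [pf rE]]; first exact: ideal_sum_ideal.
exists (fun i => comp grR N (f i)); split=> [i iF|].
  by apply: minimal_prime_homog => //; apply: pf.
split=> [i|]; first exact: comp_mem.
rewrite -comp_sum -rE comp_id // -{1}[N]mul1n; exact: gr_exp.
Qed.

(* Expanding a product over all nonfaces F of sums over F, each term gives an
   element lying in p i for every i chosen in some F, and the indices never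
   chosen form a face. *)
Lemma face_cover : exists (S : finType) (sigma : S -> {set 'I_n}) (g : S -> R)
    (d : nat),
  [/\ forall s, Rg d (g s), forall s, Delta Rg p (sigma s),
      forall s i, i \notin sigma s -> p i (g s) &
      forall r, mm r -> rad (gen_fam g) r].
Proof.
have [i0 _] := inhabited_minimal_primes.
have [m [w [Rw genw]]] := irrelevant_generated grR.
pose nf F := ~~ `[< Delta Rg p F >].
have [|N powN] := @eventually_all ('I_m * {set 'I_n})%type (fun jF N =>
    exists f : 'I_n -> R, nf jF.2 -> (forall i, i \in jF.2 -> p i (f i)) /\
    (forall i, Rg N (f i)) /\ w jF.1 ^+ N = \sum_(i in jF.2) f i).
  move=> [j F] /=; have [/nonface_power/(_ (Rw j))[N0 H]|fF] := pselect (~ Delta Rg p F).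
    by exists N0 => N /H[f Hf]; exists f.
  exists 0%N => N _; exists (fun=> 0); rewrite /nf asboolT //.
  exact: contrapT.
have {powN}[f fP] := choice (powN N (leqnn N)).
(* [fam] holds the functions choosing an index in each nonface, with default [i0] at faces. Any
   other function gets [g s = 0] and the empty face. *)
pose fam := pfamily i0 nf (fun F => mem F).
pose S : finType := ('I_m * {ffun {set 'I_n} -> 'I_n})%type.
pose g (s : S) := if s.2 \in fam then \prod_(F | nf F) f (s.1, F) (s.2 F) else 0.
pose sigma (s : S) := if s.2 \in fam then ~: [set s.2 F | F in nf] else set0.
pose d := (N * size [seq F <- index_enum {set 'I_n} | nf F])%N.
have famP (s : S) F : s.2 \in fam -> nf F -> s.2 F \in F.
  by move=> /pfamilyP[_ H] /H.
exists S, sigma, g, d; split=> [s|s|s i|r mr].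
- rewrite /g; case: ifP => sfam; last exact: gr_zero.
  rewrite -big_filter /d big_seq_cond.
  rewrite (eq_bigr (fun F => if nf F then f (s.1, F) (s.2 F) else 0)); last first.
    by move=> F; rewrite mem_filter => /andP[/andP[->]].
  rewrite -big_seq_cond (eq_big_seq (fun F => comp grR N (f (s.1, F) (s.2 F)))).
    by apply: gr_prod => // F; apply: comp_mem.
  move=> F; rewrite mem_filter => /andP[nfF _]; rewrite nfF comp_id //.
  by have [_ []] := fP (s.1, F) nfF.
- rewrite /sigma; case: ifP => sfam; last first.
    by apply: (Delta_sub (F' := [set i0])); [exact: sub0set|exact: Delta1].
  (* Were [sigma s] a nonface, the index chosen in it would also have been removed from it. *)
  apply: contrapT => /asboolPn nfs.
  have := famP s _ sfam nfs; rewrite inE => /negP; apply.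
  exact: imset_f.
- rewrite /sigma /g; case: ifP => sfam; last by case: (idp i).
  rewrite inE negbK => /imsetP[F nfF ->]; rewrite (bigD1 F) //=.
  apply: (ideal_mulr _ (idp _)).
  by have [pf _] := fP (s.1, F) nfF; apply: pf; apply: famP.
have idg := ideal_gen_fam g.
apply: (gen_fam_min (ideal_rad idg) _ (genw r mr)) => j.
pose L := #|[pred F | nf F]|.
apply: (@ideal_rad_exp _ _ _ N); apply: (@ideal_rad_exp _ _ _ L).
apply: rad_sub; rewrite -prodr_const.
rewrite (eq_bigr (fun F => \sum_(i in F) f (j, F) i)); last first.
  by move=> F nfF; have [_ []] := fP (j, F) nfF.
rewrite (big_distr_big_dep i0).
apply: ideal_big_sum => // phi phifam.
have -> : \prod_(F in [pred F | nf F]) f (j, F) (phi F) = g (j, phi).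
  by rewrite /g /= phifam.
exact: gen_fam_mem.
Qed.

(** The exponent is a successor so that the power of an element of a prime stays in that prime. *)
Lemma common_killing_exponent (S T : finType) (h c : S -> R) :
  (forall s, (exists N, h s ^+ N = 0) \/ c s = 0) ->
  exists M, forall s, h s ^+ M.+1 * c s = 0.
Proof.
move=> hc; have [|M HM] := @eventually_all S (fun s M => h s ^+ M * c s = 0).
  move=> s; case: (hc s) => [[N hN]|->]; last by exists 0%N => N _; rewrite mulr0.
  by exists N => M /subnK<-; rewrite exprD hN mulr0 mul0r.
by exists M => s; apply: HM (leqnSn M) s.
Qed.

Lemma face_cover_escape (S : finType) (g : S -> R) i :
  (forall r, mm r -> rad (gen_fam g) r) -> exists s, ~ p i (g s).
Proof.
move=> radg; apply: contrapT => /forallNP gp.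
apply: (@irrelevant_not_sub_minimal i) => r /radg[N].
move=> /(gen_fam_min (idp i)) pr; apply: (prime_exp (prp i) (n := N)).
by apply: pr => s; apply: contrapT (gp s).
Qed.

(** The values of [al] give constants on the opens [g s != 0]; these glue to an element [w] of [R],
    whose degree 0 component equals [al i] on each component [p i]. *)
Lemma Delta_connected (al : 'I_n -> k) :
  (forall i j, Delta Rg p [set i; j] -> al i = al j) ->
  exists c, forall i, al i = c.
Proof.
move=> al_edge; have [S [sg [g [d [Rgd Dsg gsg radg]]]]] := face_cover.
pose h s := if [pick i in sg s] is Some i then al i else 0.
have hE s i : i \in sg s -> h s = al i.
  rewrite /h; case: pickP => [j js is'|->//]; apply: al_edge.
  by apply: Delta_sub (Dsg s); rewrite subUset !sub1set js.
have [|M HM] := @common_killing_exponent (S * S)%type S (fun s => g s.1 * g s.2)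
    (fun s => (h s.1)%:A - (h s.2)%:A).
  (* Either the two faces share a vertex, or [g s * g u] lies in every minimal prime and is
     nilpotent. *)
  move=> [s u] /=; have [[i]|noi] := pselect (exists i, i \in sg s :&: sg u).
    by rewrite inE => /andP[/hE-> /hE->]; right; rewrite subrr.
  left; apply: nilpotent_of_minimal_primes => i.
  have [is'|/gsg gs] := boolP (i \in sg s); last exact: ideal_mulr.
  have [iu|/gsg gu] := boolP (i \in sg u); last exact: ideal_mull.
  by case: noi; exists i; rewrite inE is'.
have [w wE] := glue_sections (h := fun s => (h s)%:A) (@ideal_zero R) regx regy
  (radg _ mx) (radg _ my) (fun s u => HM (s, u)).
have [c cE] := comp0_const grR w; exists c => i.
have [s ngs] := face_cover_escape i radg.
have is' : i \in sg s by apply: contrapT => /negP/gsg.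
have Rc t : Rg 0 t%:A by apply/(gr_deg0 grR); exists t.
have := congr1 (comp grR (d * M.+1 + 0)) (wE s).
rewrite (comp_mull grR) ?comp0; last exact: gr_exp.
rewrite compB cE (comp_id grR (Rc _)) (hE s i is') -scalerBl => gc.
have : p i (g s ^+ M.+1 * (c - al i)%:A) by rewrite gc; case: (idp i).
case: (prp i) => _ [_ PM] /PM[/(prime_exp (prp i))//|/(prime_const (prp i))].
by move/eqP; rewrite subr_eq0 => /eqP.
Qed.

(* A simplicial cocycle defines a Cech cocycle of constants on the opens
   g s != 0; splitting it in R and reducing modulo each minimal prime splits a
   Frobenius power of the simplicial cocycle. *)
Lemma cocycle_power_splits (a : 'I_n -> 'I_n -> k) : separably_closed k ->
  (forall i j l, Delta Rg p [set i; j; l] -> a i j + a j l = a i l) ->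
  exists Q nu, [pchar k].-nat Q /\
    forall i j, Delta Rg p [set i; j] -> a i j ^+ Q = nu j - nu i.
Proof.
move=> sepk aZ; have [S [sg [g [d [Rgd Dsg gsg radg]]]]] := face_cover.
(* [t s] is a primitive of [a] on the simplex [sg s], based at the picked vertex; [c s u] is the
   constant by which two primitives differ on a common face. *)
pose t s i := if [pick r in sg s] is Some r then a r i else 0.
pose c s u := if [pick i in sg s :&: sg u] is Some i then t s i - t u i else 0.
have tE s i j : i \in sg s -> j \in sg s -> t s j - t s i = a i j.
  move=> is' js; rewrite /t; case: pickP => [r rs|/(_ i)]; last by rewrite is'.
  apply/eqP; rewrite subr_eq addrC eq_sym; apply/eqP; apply: aZ.
  by apply: Delta_sub (Dsg s); rewrite !subUset !sub1set rs is'.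
have cE s u i : i \in sg s -> i \in sg u -> c s u = t s i - t u i.
  move=> is' iu; rewrite /c; case: pickP => [j|/(_ i)]; last by rewrite inE is' iu.
  rewrite inE => /andP[js ju]; apply/eqP; rewrite -subr_eq0; apply/eqP.
  have -> : t s j - t u j - (t s i - t u i) = (t s j - t s i) - (t u j - t u i).
    by ring.
  by rewrite !tE // subrr.
have [|M HM] := @common_killing_exponent (S * S * S)%type S
    (fun s => g s.1.1 * g s.1.2 * g s.2)
    (fun s => (c s.1.1 s.1.2)%:A + (c s.1.2 s.2)%:A - (c s.1.1 s.2)%:A).
  move=> [[s u] v] /=.
  have [[i /and3P[is' iu iv]]|noi] :=
      pselect (exists i, [&& i \in sg s, i \in sg u & i \in sg v]).
    right; rewrite (cE _ _ _ is' iu) (cE _ _ _ iu iv) (cE _ _ _ is' iv).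
    by rewrite -scalerDl -scalerBl addrA subrK subrr scale0r.
  left; apply: nilpotent_of_minimal_primes => i.
  have [is'|/gsg gs] := boolP (i \in sg s); last by do 2!apply: ideal_mulr => //.
  have [iu|/gsg gu] := boolP (i \in sg u).
    have [iv|/gsg gv] := boolP (i \in sg v); last exact: ideal_mull.
    by case: noi; exists i; rewrite is' iu.
  by apply: ideal_mulr => //; apply: ideal_mull.
pose K := (M.+1 + M.+1)%N.
have [f fE] := split_cocycle (c := fun s u => (c s u)%:A) regx regy regz
  (radg _ mx) (radg _ my) (radg _ mz) (fun s u v => HM (s, u, v)).
rewrite -/K in fE.
pose G s := g s ^+ K; pose f' s := comp grR (d * K) (f s).
have RG s : Rg (d * K) (G s) by apply: gr_exp.
have f'E s u : G u * f' s - G s * f' u = c s u *: (G s * G u).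
  rewrite -(comp_mull grR _ _ (RG u)) -(comp_mull grR _ _ (RG s)) -compB fE.
  rewrite mulr_algl (comp_id grR) //.
  exact: (gr_scale grR _ (gr_mul grR (RG s) (RG u))).
have radG r : mm r -> rad (gen_fam G) r.
  by move=> /radg; apply: rad_gen_fam_exp.
have Gsg s i : i \notin sg s -> p i (G s).
  by move=> /gsg gs; rewrite /G /K addSn exprS; apply: ideal_mulr.
have [m [w [Rw genw]]] := irrelevant_generated grR.
(* Modulo [p i] the degree 0 fractions [f' s / G s] differ by [t s i - t u i], so subtracting
   [t s i] makes them independent of [s]. *)
have frac i : exists q mu, [pchar k].-nat q /\ forall s, i \in sg s ->
    p i ((f' s - t s i *: G s) ^+ q - mu *: G s ^+ q).
  apply: (fraction_purely_inseparable grR Rw genw (A := fun s => i \in sg s)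
    (E := (d * K)%N)) => // [r_p|s|s|s u is' iu].
  - exact: irrelevant_not_sub_minimal r_p.
  - apply: (gr_sub grR); first exact: comp_mem.
    exact: (gr_scale grR).
  - exact: Gsg.
  have -> : G u * (f' s - t s i *: G s) - G s * (f' u - t u i *: G u) = 0.
    transitivity (G u * f' s - G s * f' u - (t s i - t u i) *: (G s * G u)).
      by rewrite scalerBl !mulrBr -!scalerAr [G u * G s]mulrC; ring.
    by rewrite f'E (cE s u i) // subrr.
  by case: (idp i).
have {frac}[q /choice[mu qmu]] := choice frac.
(* The exponents [q i] depend on the component; their product is a common one, and [lam i] is [mu i]
   adjusted to it. *)
pose Q := (\prod_i q i)%N.
have kQ : [pchar k].-nat Q.
  by apply: (big_ind (fun N => [pchar k].-nat N)) => // [a1 a2|i _];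
    [rewrite pnatM => -> | case: (qmu i)].
pose lam i := mu i ^+ (\prod_(j | j != i) q j)%N.
have lamP s i : i \in sg s ->
    p i (f' s ^+ Q - (lam i + t s i ^+ Q) *: G s ^+ Q).
  move=> is'; set e := f' s - t s i *: G s.
  have -> : f' s = e + t s i *: G s by rewrite subrK.
  have RQ : [pchar R].-nat Q by rewrite (eq_pnat _ (pchar_lalg R)).
  rewrite exprDn_pchar // exprZn scalerDl opprD addrACA subrr addr0.
  rewrite /lam /Q (bigD1 i) //= !exprM -exprZn subrXX.
  apply: ideal_mulr => //; exact: (qmu i).2.
exists Q, (fun i => - lam i); split=> // i j /DeltaE nij.
(* If the equation failed, the nonzero constant [del] times each [G s ^+ Q] would lie in
   [p i + p j], and [[set i; j]] would not be a face. *)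
apply: contrapT => /eqP neq; apply: nij => r /radG[N genr].
have idij := ideal_sum_ideal [set i; j] idp.
apply: (@ideal_rad_exp _ _ _ N).
apply: (gen_fam_min (ideal_rad idij) _ genr) => s.
have [is'|/Gsg Gs] := boolP (i \in sg s); last first.
  by apply/rad_sub/(ideal_sum_mem idp _ Gs); rewrite !inE eqxx.
have [js|/Gsg Gs] := boolP (j \in sg s); last first.
  by apply/rad_sub/(ideal_sum_mem idp _ Gs); rewrite !inE eqxx orbT.
pose del := lam i - lam j - a i j ^+ Q.
have del0 : del != 0.
  by apply: contra neq; rewrite subr_eq0 opprK [- _ + _]addrC eq_sym.
exists Q; rewrite -[G s ^+ Q]scale1r -(mulVf del0) -scalerA.
apply: ideal_scale => //.
have -> : del *: G s ^+ Q = (f' s ^+ Q - (lam j + t s j ^+ Q) *: G s ^+ Q)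
    - (f' s ^+ Q - (lam i + t s i ^+ Q) *: G s ^+ Q).
  rewrite opprB addrC addrA subrK -scalerBl; congr (_ *: _).
  have -> : t s j = t s i + a i j by rewrite -(tE s i j) // addrC subrK.
  by rewrite exprDn_pchar // /del; ring.
apply: (ideal_sub idij).
  by apply: (ideal_sum_mem idp _ (lamP s j js)); rewrite !inE eqxx orbT.
by apply: (ideal_sum_mem idp _ (lamP s i is')); rewrite !inE eqxx.
Qed.
End Spectrum.

(** * Frobenius twists of cycles and the vanishing of homology *)

Lemma expr_sum_pchar (k : fieldType) (Q : nat) (T : finType) (f : T -> k) :
  [pchar k].-nat Q -> (\sum_i f i) ^+ Q = \sum_i f i ^+ Q.
Proof.
move=> kQ; apply: (big_morph (fun a => a ^+ Q)) => [a b|].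
  exact: exprDn_pchar.
by apply/eqP; rewrite expf_eq0 eqxx andbT; case/andP: kQ.
Qed.

(** Frobenius is additive and multiplicative, and it fixes the signs in the boundary. *)
Lemma bdry_frobenius (k : fieldType) (n Q : nat) (c : {set 'I_n} -> k) G :
  [pchar k].-nat Q -> bdry c G = 0 -> bdry (fun F => c F ^+ Q) G = 0.
Proof.
move=> kQ c0; have <- : bdry c G ^+ Q = 0.
  by rewrite c0; apply/eqP; rewrite expf_eq0 eqxx andbT; case/andP: kQ.
rewrite /bdry big_mkcond [in RHS]big_mkcond expr_sum_pchar //.
apply: eq_bigr => v _; case: ifP => _; last first.
  by apply/esym/eqP; rewrite expf_eq0 eqxx andbT; case/andP: kQ.
by rewrite exprMn exprAC (exprNn_pchar _ kQ) expr1n.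
Qed.

Theorem theorem1p3 (k : fieldType) (R : comAlgType k) (Rg : nat -> R -> Prop)
  (n : nat) (p : 'I_n -> R -> Prop) :
  separably_closed k ->
  std_graded Rg ->
  (* p_1, ..., p_n is an enumeration without repetition of the minimal primes *)
  (forall i, is_minimal_prime (p i)) ->
  (forall P : R -> Prop, is_minimal_prime P -> exists i, same_set P (p i)) ->
  (forall i j, same_set (p i) (p j) -> i = j) ->
  depth_ge (irrelevant_ideal Rg) 3 ->
  reduced_homology_vanishes k (Delta Rg p) 0 /\
  reduced_homology_vanishes k (Delta Rg p) 1.
Proof.
move=> sepk grR minp allp injp /depth_ge3_regular[x [y [z]]].
case=> [[mx my mz] [regx regy regz]]; split=> c suppc bdc;
  apply: chain_bounds => al al_ann.
  have [i j ij|C alC] := Delta_connected grR minp allp injp mx my regx regy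
      (al := fun i => al [set i]).
    have [->//|neq_ij] := eqVneq i j.
    have := al_ann _ ij; rewrite cards2 neq_ij cobdry1 // => /(_ erefl).
    by case: ifP => _ /eqP; rewrite subr_eq0 => /eqP.
  (* A constant 0-cochain is the coboundary of the value [C] at the empty set, so it pairs to zero
     with a reduced cycle. *)
  rewrite -[RHS](_ : \sum_G bdry c G * (C *+ (G == set0)) = 0); last first.
    by rewrite big1 // => G _; rewrite bdc mul0r.
  rewrite bdry_pairing; apply: eq_bigr => G _.
  have [->|/suppc[_ /eqP/cards1P[v ->]]] := eqVneq (c G) 0; first by rewrite !mul0r.
  rewrite alC /cobdry big_set1 setDv eqxx (eqP (_ : #|_| == 0)) ?mul1r //.
  by rewrite cards_eq0; apply/eqP/setP => u; rewrite !inE.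
(* The cocycle on unordered edges becomes an alternating function of ordered pairs; [aZ] for
   increasing triples then yields every order by antisymmetry. *)
pose a (i j : 'I_n) := if (i < j)%N then al [set i; j] else
  if (j < i)%N then - al [set i; j] else 0.
have aii i : a i i = 0 by rewrite /a ltnn.
have aC i j : a j i = - a i j.
  by rewrite /a setUC; case: ltngtP; rewrite ?opprK ?oppr0.
have aZ (i j l : 'I_n) : (i < j)%N -> (j < l)%N -> Delta Rg p [set i; j; l] ->
    a i j + a j l = a i l.
  move=> ij jl Dijl; have il := ltn_trans ij jl.
  have := al_ann _ Dijl; rewrite cobdry2 // /a ij jl il.
  have -> : #|[set i; j; l]| = 3%N.
    rewrite setUC cardsU1 cards2 !inE negb_or -!val_eqE /=.
    by rewrite (gtn_eqF il) (gtn_eqF jl) (ltn_eqF ij).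
  move=> /(_ erefl)/eqP; rewrite addrAC subr_eq0 addrC => /eqP <-.
  by rewrite addrC.
have [i j l Dijl|Q [nu [kQ anu]]] := cocycle_power_splits grR minp allp injp
    mx my mz regx regy regz (a := a) sepk.
  have P1 : [set i; j; l] = [set i; l; j] by rewrite setUAC.
  have P2 : [set i; j; l] = [set j; i; l] by rewrite [X in X :|: _]setUC.
  have P3 : [set i; j; l] = [set j; l; i] by rewrite -setUA setUC.
  have P4 : [set i; j; l] = [set l; i; j] by rewrite setUC setUA.
  have P5 : [set i; j; l] = [set l; j; i] by rewrite setUC [X in _ :|: X]setUC setUA.
  case: (ltngtP i j) => [ij|ji|/val_inj ->]; last by rewrite aii add0r.
    case: (ltngtP j l) => [jl|lj|/val_inj <-]; last by rewrite aii addr0.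
      exact: aZ.
    case: (ltngtP i l) => [il|li|/val_inj <-]; last first.
    - by rewrite aii (aC i j) subrr.
    - rewrite P4 in Dijl.
      by rewrite (aC l j) (aC l i) -(aZ _ _ _ li ij Dijl); ring.
    - by rewrite P1 in Dijl; rewrite (aC l j) -(aZ _ _ _ il lj Dijl); ring.
  case: (ltngtP j l) => [jl|lj|/val_inj <-]; last by rewrite aii addr0.
    case: (ltngtP i l) => [il|li|/val_inj <-]; last first.
    - by rewrite aii (aC j i) addNr.
    - by rewrite P3 in Dijl; rewrite (aC j i) (aC l i) -(aZ _ _ _ jl li Dijl); ring.
    - by rewrite P2 in Dijl; rewrite (aC j i) -(aZ _ _ _ ji il Dijl); ring.
  rewrite P5 in Dijl; rewrite (aC j i) (aC l j) (aC l i) -(aZ _ _ _ lj ji Dijl).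
  by ring.
have Q_gt0 : (0 < Q)%N by case/andP: kQ.
apply/eqP; rewrite -[_ == 0](andb_idl (a := (0 < Q)%N)) // -expf_eq0.
rewrite expr_sum_pchar //; apply/eqP.
(* [T] takes the value [nu v] at the vertex [v], so on edges its coboundary is the [Q]-th power of
   [al]; it pairs to zero with the Frobenius twist of [c]. *)
pose T (G : {set 'I_n}) := \sum_(v in G) nu v.
rewrite -[RHS](_ : \sum_G bdry (fun F => c F ^+ Q) G * T G = 0); last first.
  by rewrite big1 // => G _; rewrite bdry_frobenius ?mul0r.
rewrite bdry_pairing; apply: eq_bigr => G _; rewrite exprMn.
have [->|/suppc[DG /eqP/cards2P[i [j [neq_ij GE]]]]] := eqVneq (c G) 0.
  by rewrite expr0n eqn0Ngt Q_gt0 !mul0r.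
congr (_ * _); rewrite GE in DG *; rewrite cobdry1 // /T !big_set1.
case: ltngtP => [ij|ji|/val_inj ij]; last by rewrite ij eqxx in neq_ij.
  by rewrite -anu // /a ij.
by rewrite setUC in DG *; rewrite -anu // /a ji.
Qed.
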